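(* Let $Q,P_{\max},P_p,\sigma^2,\overline g,\overline h,\overline q>0$ and let $F_\gamma$ be the per-antenna SINR distribution function defined in the context. For each integer $N\ge 1$ let $R_{\max}$ be a nonnegative random variable with $\Pr\{R_{\max}\le r\}=[F_\gamma(e^r-1)]^N$ for $r\ge 0$, and let $C_s=\mathbb E[R_{\max}]$ be the secondary user mean capacity. Put $$a_N=\log\left[1+F_\gamma^{-1}\left(1-\tfrac1N\right)\right],\qquad b_N=\log\left[\frac{1+F_\gamma^{-1}\left(1-\frac1{Ne}\right)}{1+F_\gamma^{-1}\left(1-\frac1N\right)}\right].$$ Then $C_s\approx a_N+b_N\mathrm E_0$ asymptotically as $N\to\infty$, in the sense that $$\lim_{N\to\infty}\frac{C_s-a_N}{b_N}=\mathrm E_0,$$ where $\mathrm E_0=0.5772\ldots$ is the Euler constant.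
   Context: Logarithms are natural and $e$ is their base. $F_\gamma$ is the cumulative distribution function of $$\gamma=\min\left\{\frac{Q\,g}{h\,(P_p q+\sigma^2)},\ \frac{P_{\max}\,g}{P_p q+\sigma^2}\right\},$$ where $g,h,q$ are independent exponential random variables with means $\overline g,\overline h,\overline q$; $F_\gamma^{-1}$ is its inverse on $[0,1)$. The rate using one antenna is $R=\log(1+\gamma)$. With transmit antenna selection among $N$ antennas, the rate is the maximum of the $N$ per-antenna rates, and by convention the per-antenna SINRs are treated as i.i.d., so the maximum SINR has distribution function $[F_\gamma(x)]^N$. *)

(* Defs.v *)
From HB Require Import structures.
From mathcomp Require Import all_boot all_order all_algebra.
From mathcomp Require Import all_classical all_reals all_analysis.
From mathcomp Require Import measurable_realfun.

Set Implicit Arguments.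
Unset Strict Implicit.
Unset Printing Implicit Defensive.

Import Order.TTheory GRing.Theory Num.Theory.
Import numFieldNormedType.Exports.

Local Open Scope classical_set_scope.
Local Open Scope ring_scope.

Section random_variables.
Context {d : measure_display} {T : measurableType d} {R : realType}.
Variable P : probability T R.

(* The exponential distribution with mean m has rate 1 / m. *)
Definition exponential_with_mean (X : {RV P >-> R}) (m : R) : Prop :=
  forall A : set R, measurable A ->
    distribution P X A = exponential_prob m^-1 A.

(* Taking some of A, B, C to be setT gives the product rule for subfamilies. *)
Definition independent3 (X Y Z : {RV P >-> R}) : Prop :=
  forall A B C : set R, measurable A -> measurable B -> measurable C ->
    (P (X @^-1` A `&` Y @^-1` B `&` Z @^-1` C) =
     P (X @^-1` A) * P (Y @^-1` B) * P (Z @^-1` C))%E.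

End random_variables.

Section sinr.
Context {d : measure_display} {T : measurableType d} {R : realType}.
Variables (Q Pmax Pp sigma2 : R).

(* The divisions are total (x / 0 = 0); for exponential g, h, q a denominator
   vanishes only on a null set. *)
Definition sinr (g h q : {mfun T >-> R}) (w : T) : R :=
  Num.min ((Q * g w) / (h w * (Pp * q w + sigma2)))
          ((Pmax * g w) / (Pp * q w + sigma2)).

Lemma measurable_inv : measurable_fun [set: R] (@GRing.inv R).
Proof.
rewrite -(setUv [set 0 : R]); apply/measurable_funU => //.
  exact: measurableC.
split.
  apply: (@eq_measurable_fun _ _ R R [set 0] (cst 0)) => [x|].
    by rewrite inE /= => ->; rewrite invr0.
  exact: measurable_cst.
apply: open_continuous_measurable_fun.
  by apply: closed_openC; exact: closed_eq.
by move=> x; rewrite inE /= => /eqP; exact: inv_continuous.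
Qed.

Lemma measurable_sinr (g h q : {mfun T >-> R}) :
  measurable_fun [set: T] (sinr g h q).
Proof.
have mD : measurable_fun [set: T] (fun w => Pp * q w + sigma2).
  by apply: measurable_funD => //; exact: measurable_funM.
apply: measurable_minr.
  apply: measurable_funM; first exact: measurable_funM.
  apply: (measurableT_comp measurable_inv).
  exact: measurable_funM.
apply: measurable_funM; first exact: measurable_funM.
exact: (measurableT_comp measurable_inv).
Qed.

HB.instance Definition _ (g h q : {mfun T >-> R}) :=
  isMeasurableFun.Build _ _ T R (sinr g h q) (measurable_sinr g h q).

Definition sinr_cdf (P : probability T R) (g h q : {RV P >-> R}) (x : R) : R :=
  fine (cdf (sinr g h q : {RV P >-> R}) x).

End sinr.

Section capacity_constants.
Context {R : realType}.
Variable F : R -> R.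

(* Inverse of the restriction of F to [0, +oo[; a distribution function of a
   nonnegative variable takes the value 0 on all of ]-oo, 0[. *)
Definition cdf_inv : R -> R := 'pinv_(fun=> 0) `[0, +oo[ F.

Definition capacity_a (N : nat) : R := ln (1 + cdf_inv (1 - N%:R^-1)).

Definition capacity_b (N : nat) : R :=
  ln ((1 + cdf_inv (1 - (N%:R * expR 1)^-1)) / (1 + cdf_inv (1 - N%:R^-1))).

End capacity_constants.

Definition euler_constant (R : realType) : R :=
  limn (fun n : nat => (\sum_(1 <= k < n.+1) k%:R^-1) - ln n%:R : R).

(* Main.v *)
(* Conditionally on the interference, the SINR is exponential, so its survival
   function is a Laplace transform S x = E[exp (- x W)], where W >= beta > 0 and
   beta is the essential infimum of W.  Hence the cumulative hazard L = - ln S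
   has increments between beta * (y - x) (as W >= beta) and
   (y - x) * (L x / x) (by Jensen), and L x / x tends to beta.  With
   x_N = L^-1 (ln N) and z_N = L^-1 (ln N + 1), this forces
   L ((1 + x_N) * exp (b_N s) - 1) - ln N --> s, i.e. (R_max - a_N) / b_N
   converges to the Gumbel law; explicit tail bounds and dominated convergence
   give convergence of the means.  That the Gumbel mean is the Euler constant
   comes from the same limit for the maximum of N independent exponentials of
   mean 1, whose recentred mean is exactly 1 + 1/2 + ... + 1/N - ln N. *)
Require Import Defs.
From HB Require Import structures.
From mathcomp Require Import all_boot all_order all_algebra.
From mathcomp Require Import all_classical all_reals all_analysis.
From mathcomp Require Import measurable_realfun.
From mathcomp Require Import ring lra.
Import Order.TTheory GRing.Theory Num.Theory.
Import numFieldNormedType.Exports.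
Local Open Scope classical_set_scope.
Local Open Scope ring_scope.

(** * Elementary bounds for [ln], [expR] and powers of [1 - q] *)

Section elementary.
Context {R : realType}.
Implicit Types x u : R.

Lemma ln1D_ge u : 0 <= u -> u / (1 + u) <= ln (1 + u).
Proof.
move=> u0; have u1 : 0 < 1 + u by lra.
rewrite -[ln _]opprK -lnV ?posrE// lerNr.
have eV : (1 + u)^-1 = 1 + - (u / (1 + u)) by field; lra.
rewrite [in ln _]eV; apply: le_ln1Dx; rewrite ltrN2 ltr_pdivrMr//; lra.
Qed.

Lemma expRB1_le x : x < 1 -> expR x - 1 <= x / (1 - x).
Proof.
move=> x1; have x0 : 0 < 1 - x by lra.
have := expR_ge1Dx (- x); rewrite expRN => h.
have e0 := expR_gt0 x.
have : expR x <= (1 - x)^-1.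
  by rewrite -[expR x]invrK lef_pV2 ?posrE ?invr_gt0.
have -> : x / (1 - x) = (1 - x)^-1 - 1 by field; lra.
lra.
Qed.

(** The logarithm [n * ln (1 - q n)] is squeezed between [- n * q n / (1 - q n)] and [- n * q n];
    convergence of [n * q n] forces [q n] to tend to [0]. *)
Lemma cvg_expr_expRN (q : nat -> R) (t : R) :
  (forall n, 0 <= q n <= 1) -> n%:R * q n @[n --> \oo] --> t ->
  (1 - q n) ^+ n @[n --> \oo] --> expR (- t).
Proof.
move=> q01 qt.
have q0 : q n @[n --> \oo] --> (0 : R).
  have : (n%:R^-1 * (n%:R * q n)) @[n --> \oo] --> 0 * t.
    (* [harmonic n] is [n.+1%:R^-1], hence the index shift. *)
    apply: cvgM => //; rewrite -cvg_shiftS; exact: cvg_harmonic.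
  rewrite mul0r; apply: cvg_trans; apply: near_eq_cvg; near=> n.
  rewrite mulKf// pnatr_eq0 -lt0n; near: n; exact: nbhs_infty_gt.
have q1 : 1 - q n @[n --> \oo] --> (1 : R).
  by rewrite -[X in _ --> X]subr0; apply: cvgB => //; exact: cvg_cst.
have : n%:R * ln (1 - q n) @[n --> \oo] --> - t.
  apply: (@squeeze_cvgr _ _ _ _ (fun n => - (n%:R * q n / (1 - q n)))
    (fun n => - (n%:R * q n))).
  - near=> n.
    have qn : 0 < 1 - q n.
      by near: n; apply: (cvgr_gt 1) => //.
    have /andP[qn0 _] := q01 n.
    apply/andP; split.
      rewrite -mulrA -mulrN ler_wpM2l//.
      have -> : 1 - q n = (1 + q n / (1 - q n))^-1 by field; lra.
      rewrite lnV ?posrE; last by rewrite ltr_wpDr// divr_ge0// ltW.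
      rewrite invrK lerN2.
      apply: le_trans (le_ln1Dx _) _; last first.
        by rewrite le_eqVlt; apply/orP; left; apply/eqP; field; lra.
      by apply: (@lt_le_trans _ _ 0); [lra|rewrite divr_ge0// ltW].
    rewrite -mulrN ler_wpM2l//.
    by apply: le_ln1Dx; lra.
  - apply: cvgN; rewrite -[X in _ --> X]divr1.
    apply: cvgM => //; apply: cvgV => //; exact: oner_neq0.
  - exact: cvgN.
move=> h.
have : expR (n%:R * ln (1 - q n)) @[n --> \oo] --> expR (- t).
  by apply: (cvg_comp _ _ h); exact: continuous_expR.
apply: cvg_trans; apply: near_eq_cvg; near=> n.
rewrite expRM_natl lnK// posrE.
by near: n; apply: (cvgr_gt 1) => //.
Unshelve. all: by end_near. Qed.

(** Bernoulli's inequality, by induction on [n]: the union bound for a maximum of [n] variables,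
    used on right tails. *)
Lemma one_minus_exprn_le (q : R) n : 0 <= q <= 1 -> 1 - (1 - q) ^+ n <= n%:R * q.
Proof.
move=> /andP[q0 q1]; elim: n => [|n ih]; first by rewrite expr0 mul0r subrr.
rewrite exprS -natr1.
have : (1 - q) ^+ n <= 1 by apply: exprn_ile1; lra.
move: ih; set u := (1 - q) ^+ n => ih u1.
nra.
Qed.

Lemma exprn_le_expRN (q : R) n : q <= 1 -> (1 - q) ^+ n <= expR (- (n%:R * q)).
Proof.
move=> q1; rewrite -mulrN expRM_natl lerXn2r ?nnegrE ?expR_ge0//; first lra.
exact: expR_ge1Dx.
Qed.

End elementary.

(** * Quantiles and increments of a cumulative hazard *)

Section cumulative_hazard.
Context {R : realType}.
Variables (L : R -> R) (beta : R).
Hypothesis beta_gt0 : 0 < beta.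
Hypothesis L0 : L 0 = 0.
Hypothesis L_ge : forall x y : R, 0 <= x -> x <= y -> beta * (y - x) <= L y - L x.
Hypothesis L_le : forall x y : R, 0 < x -> x <= y -> L y - L x <= (y - x) * (L x / x).
Hypothesis cvg_L_ratio : L x / x @[x --> +oo] --> beta.
Variables (x z : nat -> R).
Hypothesis x_ge0 : \forall n \near \oo, 0 <= x n.
Hypothesis z_ge0 : \forall n \near \oo, 0 <= z n.
Hypothesis Lx : \forall n \near \oo, L (x n) = ln n%:R.
Hypothesis Lz : \forall n \near \oo, L (z n) = ln n%:R + 1.

Let m n := 1 + x n.
Let b n := ln ((1 + z n) / (1 + x n)).
(** The level with [ln (1 + y n s) = ln (m n) + b n * s] when [m n > 0], that is [a_n + b_n * s] on
    the scale of rates. *)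
Let y n s := m n * expR (b n * s) - 1.

Let L_homo (u v : R) : 0 <= u -> u <= v -> L u <= L v.
Proof.
move=> u0 uv; rewrite -subr_ge0; apply: le_trans (L_ge _ _ u0 uv).
by rewrite mulr_ge0 ?subr_ge0// ltW.
Qed.

Let L1_gt0 : 0 < L 1.
Proof.
have := L_ge 0 1 (lexx _) ler01; rewrite L0 !subr0 mulr1.
exact: lt_le_trans.
Qed.

(** [L_le] at [1] gives [L u <= L 1 * u] for [u >= 1], and [L u <= L 1] on [[0, 1]]; hence
    [ln n <= L 1 * (1 + x n)]. *)
Lemma quantile_pinfty : x n @[n --> \oo] --> +oo.
Proof.
have h : (L 1)^-1 * ln n%:R - 1 @[n --> \oo] --> +oo.
  apply: cvg_trans (_ : _ --> +oo) => //.
  apply/cvgryPge => A.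
  have := @cvgr_idn R => /cvgryPge/(_ (expR (L 1 * (A + 1)))) H.
  near=> n.
  have : expR (L 1 * (A + 1)) <= n%:R by near: n.
  move=> e; rewrite lerBrDr -(ler_pM2l L1_gt0) mulVKf ?gt_eqF// -[leLHS]expRK ler_ln ?posrE ?expR_gt0//.
  exact: lt_le_trans (expR_gt0 _) e.
apply: ger_cvgy h; near=> n.
have x0 : 0 <= x n by near: n.
have : L (x n) = ln n%:R by near: n.
move=> <-; rewrite lerBlDr ler_pdivrMl//.
have [x1|x1] := leP (x n) 1.
  by apply: le_trans (L_homo _ _ x0 x1) _; rewrite ler_peMr// ?lerDr// ltW.
have := L_le 1 (x n) ltr01 (ltW x1); rewrite divr1.
have := L1_gt0; lra.
Unshelve. all: by end_near. Qed.

Let m_pinfty : m n @[n --> \oo] --> +oo.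
Proof.
apply: ger_cvgy quantile_pinfty; near=> n; rewrite /m lerDr//.
Unshelve. all: by end_near. Qed.

Let mV_cvg0 : (m n)^-1 @[n --> \oo] --> (0 : R).
Proof.
apply/(gtr0_cvgV0 _).2 => //; near=> n.
near: n; move/cvgryPgt : m_pinfty; exact.
Unshelve. all: by end_near. Qed.

Let x_le_z : \forall n \near \oo, x n <= z n.
Proof.
near=> n; rewrite leNgt; apply/negP => zx.
have : L (z n) <= L (x n) by apply: L_homo; [near: n|exact: ltW].
have -> : L (x n) = ln n%:R by near: n.
have -> : L (z n) = ln n%:R + 1 by near: n.
lra.
Unshelve. all: by end_near. Qed.

(** [L] rises by exactly [1] from [x n] to [z n], with mean slope between [beta] and
    [L (x n) / x n], which tends to [beta]. *)
Let gap_cvg : z n - x n @[n --> \oo] --> beta^-1.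
Proof.
have k : L (x n) / x n @[n --> \oo] --> beta.
  exact: (cvg_comp _ _ quantile_pinfty cvg_L_ratio).
apply: (@squeeze_cvgr _ _ _ _ (fun n => (L (x n) / x n)^-1) (fun=> beta^-1));
  [|by apply: cvgV k; rewrite gt_eqF|exact: cvg_cst].
near=> n.
have x0 : 0 < x n by near: n; move/cvgryPgt : quantile_pinfty; exact.
have xz : x n <= z n by near: n.
have := L_ge _ _ (ltW x0) xz; have := L_le _ _ x0 xz.
have -> : L (z n) = ln n%:R + 1 by near: n.
have -> : ln n%:R + 1 - L (x n) = 1.
  have -> : L (x n) = ln n%:R by near: n.
  lra.
move=> h1 h2; apply/andP; split; last first.
  by rewrite -[leRHS]mul1r ler_pdivlMr// mulrC.
have k0 : 0 < L (x n) / x n by near: n; exact: (cvgr_gt beta).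
by rewrite -[leLHS]mul1r ler_pdivrMr.
Unshelve. all: by end_near. Qed.

Let bE n : 0 < m n -> b n = ln (1 + (z n - x n) / m n).
Proof. by rewrite /b /m => m0; congr ln; field; lra. Qed.

Lemma quantile_gap_ge0 : \forall n \near \oo, 0 <= b n.
Proof.
near=> n.
have m0 : 0 < m n by near: n; move/cvgryPgt : m_pinfty; exact.
rewrite bE//; apply: ln_ge0; rewrite lerDl divr_ge0// ?(ltW m0)// subr_ge0.
by near: n.
Unshelve. all: by end_near. Qed.

(** [b n = ln (1 + d)] with [d = (z n - x n) / m n] tending to [0], so [m n * b n] has the same
    limit as [z n - x n]. *)
Let mb_cvg : m n * b n @[n --> \oo] --> beta^-1.
Proof.
apply: (@squeeze_cvgr _ _ _ _ (fun n => (z n - x n) / (1 + (z n - x n) * (m n)^-1))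
   (fun n => z n - x n)) => //.
  near=> n.
  have m0 : 0 < m n by near: n; move/cvgryPgt : m_pinfty; exact.
  have xz : x n <= z n by near: n.
  have d0 : 0 <= (z n - x n) / m n.
    by rewrite divr_ge0// ?(ltW m0)// subr_ge0.
  rewrite bE//; apply/andP; split.
    have := ln1D_ge _ d0; rewrite -(ler_pM2l m0); apply: le_trans.
    rewrite le_eqVlt; apply/orP; left; apply/eqP; field.
    by apply/andP; split; lra.
  rewrite mulrC -ler_pdivlMr//; apply: le_ln1Dx; lra.
have -> : beta^-1 = beta^-1 / (1 + beta^-1 * 0) by rewrite mulr0 addr0 divr1.
apply: cvgM => //; apply: cvgV; first by rewrite mulr0 addr0 oner_neq0.
apply: cvgD; first exact: cvg_cst.
by apply: cvgM.
Unshelve. all: by end_near. Qed.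

Let b_cvg0 : b n @[n --> \oo] --> (0 : R).
Proof.
have : (m n)^-1 * (m n * b n) @[n --> \oo] --> 0 * beta^-1 by apply: cvgM.
rewrite mul0r; apply: cvg_trans; apply: near_eq_cvg; near=> n.
rewrite mulKf// gt_eqF//; near: n; move/cvgryPgt : m_pinfty; exact.
Unshelve. all: by end_near. Qed.

Lemma quantile_gap_gt0 : \forall n \near \oo, 0 < b n.
Proof.
near=> n.
have m0 : 0 < m n by near: n; move/cvgryPgt : m_pinfty; exact.
have : 0 < m n * b n by near: n; apply: (cvgr_gt beta^-1) => //; rewrite invr_gt0.
by rewrite pmulr_rgt0.
Unshelve. all: by end_near. Qed.

Lemma quantile_scale_cvg : beta * (m n * b n) @[n --> \oo] --> (1 : R).
Proof.
by rewrite -[X in _ --> X](mulfV (lt0r_neq0 beta_gt0)); apply: cvgM => //; exact: cvg_cst.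
Qed.

(** [y n s - x n = m n * (expR (b n * s) - 1)], whose first-order term is [m n * b n * s] because
    [b n] tends to [0]. *)
Let y_sub s : y n s - x n @[n --> \oo] --> beta^-1 * s.
Proof.
have mbs : m n * b n * s @[n --> \oo] --> beta^-1 * s.
  by apply: cvgM => //; exact: cvg_cst.
have bs : b n * s @[n --> \oo] --> (0 : R).
  by rewrite -[X in _ --> X](mul0r s); apply: cvgM => //; exact: cvg_cst.
apply: (@squeeze_cvgr _ _ _ _ (fun n => m n * b n * s)
   (fun n => m n * b n * s / (1 - b n * s))) => //; last first.
  rewrite -[X in _ --> X]divr1; apply: cvgM => //.
  apply: cvgV; first exact: oner_neq0.
  by rewrite -[X in _ --> X]subr0; apply: cvgB => //; exact: cvg_cst.
near=> n.
have m0 : 0 < m n by near: n; move/cvgryPgt : m_pinfty; exact.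
have bs1 : b n * s < 1 by near: n; exact: (cvgr_lt 0).
have -> : y n s - x n = m n * (expR (b n * s) - 1) by rewrite /y /m; ring.
rewrite -!mulrA !ler_pM2l//.
have := expR_ge1Dx (b n * s); have := expRB1_le _ bs1; rewrite mulrA; lra.
Unshelve. all: by end_near. Qed.

Lemma shifted_quantile_pinfty (s : R) : y n s @[n --> \oo] --> +oo.
Proof.
have h : x n + (beta^-1 * s - 1) @[n --> \oo] --> +oo.
  exact: (cvg_comp _ _ quantile_pinfty (cvg_addrr _)).
apply: ger_cvgy h; near=> n.
suff : beta^-1 * s - 1 <= y n s - x n by lra.
near: n; apply: (cvgr_ge (beta^-1 * s)) => //; lra.
Unshelve. all: by end_near. Qed.

(** The mean slope of [L] between [x n] and [y n s] lies between [beta] and the ratio [L u / u] at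
    the smaller point [u], which is [x n] for [s >= 0] and [y n s] for [s < 0]. *)
Lemma hazard_increment_cvg s : L (y n s) - L (x n) @[n --> \oo] --> s.
Proof.
have sE : beta * (beta^-1 * s) = s by rewrite mulVKf// gt_eqF.
have k u : u n @[n --> \oo] --> +oo -> L (u n) / u n @[n --> \oo] --> beta.
  by move=> uy; exact: (cvg_comp _ _ uy cvg_L_ratio).
have lin : beta * (y n s - x n) @[n --> \oo] --> s.
  by rewrite -[X in _ --> X]sE; apply: cvgM => //; exact: cvg_cst.
have [s0|s0] := leP 0 s.
  apply: (@squeeze_cvgr _ _ _ _ (fun n => beta * (y n s - x n))
     (fun n => (y n s - x n) * (L (x n) / x n))) => //; last first.
    rewrite -[X in _ --> X]sE mulrC; apply: cvgM => //; exact: k quantile_pinfty.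
  near=> n.
  have x0 : 0 < x n by near: n; move/cvgryPgt : quantile_pinfty; exact.
  have xy : x n <= y n s.
    have b0 : 0 <= b n by near: n; exact: quantile_gap_ge0.
    rewrite /y lerBrDr addrC ler_peMr//; first by rewrite /m; lra.
    by rewrite -expR0 ler_expR mulr_ge0.
  by rewrite L_ge ?(ltW x0)// L_le.
apply: (@squeeze_cvgr _ _ _ _ (fun n => (y n s - x n) * (L (y n s) / y n s))
   (fun n => beta * (y n s - x n))) => //; last first.
  rewrite -[X in _ --> X]sE mulrC; apply: cvgM => //; exact: k (shifted_quantile_pinfty s).
near=> n.
have y0 : 0 < y n s by near: n; move/cvgryPgt : (shifted_quantile_pinfty s); exact.
have yx : y n s <= x n.
  have b0 : 0 <= b n by near: n; exact: quantile_gap_ge0.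
  have x0 : 0 < x n by near: n; move/cvgryPgt : quantile_pinfty; exact.
  rewrite /y lerBlDr addrC ler_piMr//; first by rewrite /m; lra.
  by rewrite -expR0 ler_expR mulr_ge0_le0// ltW.
have := L_ge _ _ (ltW y0) yx; have := L_le _ _ y0 yx.
set k1 := L (y n s) / _; lra.
Unshelve. all: by end_near. Qed.

(** Controls the right tail with one threshold on [n] for all [s]: [expR (b n * s) - 1 >= b n * s]
    holds for every [s], and [beta * (m n * b n)], which tends to [1], eventually exceeds
    [1 / 2]. *)
Lemma hazard_increment_ge : \forall n \near \oo, forall s : R, 0 <= s ->
  s / 2 <= L (y n s) - L (x n).
Proof.
near=> n => s s0.
have x0 : 0 < x n by near: n; move/cvgryPgt : quantile_pinfty; exact.
have b0 : 0 <= b n by near: n; exact: quantile_gap_ge0.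
have yE : y n s - x n = m n * (expR (b n * s) - 1) by rewrite /y /m; ring.
have bs : b n * s <= expR (b n * s) - 1.
  by have := expR_ge1Dx (b n * s); lra.
have ge : m n * (b n * s) <= y n s - x n.
  by rewrite yE ler_wpM2l// /m; lra.
have bs0 : 0 <= m n * (b n * s) by rewrite !mulr_ge0// /m; lra.
apply: le_trans (L_ge _ _ (ltW x0) _); last lra.
apply: (@le_trans _ _ (beta * (m n * (b n * s)))); last by rewrite ler_pM2l.
have : 2^-1 <= beta * (m n * b n).
  by near: n; apply: (cvgr_ge 1); [exact: quantile_scale_cvg|lra].
by move=> /(ler_wpM2r s0); lra.
Unshelve. all: by end_near. Qed.

(* On the left tail the increment grows only like a square root, because
   [y n (- t)] is cut at [0], that is [b n * t <= ln (m n)]. *)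
Lemma hazard_increment_sqr_ge : \forall n \near \oo, forall t : R, 0 <= t ->
  0 <= y n (- t) ->
  0 <= L (x n) - L (y n (- t)) /\
  t ^+ 2 / 4 <= (1 + 4 / beta * t) * (L (x n) - L (y n (- t))) ^+ 2.
Proof.
near=> n => t t0 y0.
have x0 : 0 < x n by near: n; move/cvgryPgt : quantile_pinfty; exact.
have b0 : 0 <= b n by near: n; exact: quantile_gap_ge0.
have m1 : 1 <= m n by rewrite /m; lra.
have mb1 : 2^-1 <= beta * (m n * b n).
  by near: n; apply: (cvgr_ge 1); [exact: quantile_scale_cvg|lra].
have mb2 : beta * (m n * b n) <= 2.
  by near: n; apply: (cvgr_le 1); [exact: quantile_scale_cvg|lra].
set v := b n * t.
have v0 : 0 <= v by exact: mulr_ge0.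
have yE : x n - y n (- t) = m n * (1 - expR (- v)) by rewrite /y /m mulrN; ring.
have ev : expR (- v) <= (1 + v)^-1.
  by rewrite expRN lef_pV2 ?posrE ?expR_gt0 ?expR_ge1Dx//; lra.
(* Nonnegativity of [y n (- t)] means [expR v <= m n]. *)
have vm : 1 + v <= m n.
  have : 1 <= m n * expR (- v) by move: y0; rewrite /y mulrN; lra.
  rewrite expRN ler_pdivlMr ?expR_gt0// mul1r.
  have := expR_ge1Dx v; lra.
have yx : y n (- t) <= x n.
  have : 0 <= m n * (1 - expR (- v)).
    by rewrite mulr_ge0//; [lra|rewrite subr_ge0 -expR0 ler_expR oppr_le0].
  by rewrite -yE; lra.
have Lge := L_ge _ _ y0 yx.
set D := L (x n) - L (y n (- t)) in Lge *.
have D0 : 0 <= D by apply: le_trans Lge; rewrite mulr_ge0 ?(ltW beta_gt0)//; lra.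
split => //.
(* Combines [1 - expR (- v) >= v / (1 + v)] with the lower bound [1 / 2] on [beta * (m n * b n)]. *)
have tD : t / 2 <= (1 + v) * D.
  apply: (@le_trans _ _ (beta * (m n * v))).
    by move: mb1 => /(ler_wpM2r t0); rewrite /v; lra.
  have h : v <= (1 + v) * (1 - expR (- v)).
    have : (1 + v) * expR (- v) <= 1 by rewrite mulrC -ler_pdivlMr ?mul1r//; lra.
    lra.
  apply: (@le_trans _ _ ((1 + v) * (beta * (x n - y n (- t))))); last first.
    by rewrite ler_wpM2l//; lra.
  rewrite yE.
  have -> : (1 + v) * (beta * (m n * (1 - expR (- v)))) =
     (beta * m n) * ((1 + v) * (1 - expR (- v))) by ring.
  by rewrite mulrA ler_wpM2l// mulr_ge0//; [exact: ltW|lra].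
apply: (@le_trans _ _ (((1 + v) * D) ^+ 2)).
  have -> : t ^+ 2 / 4 = (t / 2) ^+ 2 by field.
  by rewrite lerXn2r// nnegrE ?divr_ge0// mulr_ge0//; lra.
(* It remains to bound [(1 + v) ^+ 2 = 1 + v * (2 + v)]: [2 + v <= 2 * m n] by [vm], and
   [m n * v <= 2 / beta * t] by [mb2]. *)
rewrite exprMn ler_wpM2r ?sqr_ge0//.
have : m n * v <= 2 / beta * t.
  rewrite -(ler_pM2l beta_gt0).
  have -> : beta * (2 / beta * t) = 2 * t by field; rewrite gt_eqF.
  by move: mb2 => /(ler_wpM2r t0); rewrite /v; lra.
have : v * (2 + v) <= v * (2 * m n) by rewrite ler_wpM2l//; lra.
have -> : 4 / beta * t = 2 * (2 / beta * t) by ring.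
lra.
Unshelve. all: by end_near. Qed.

End cumulative_hazard.

(** * Dominated convergence under an eventual bound *)

Section near_dominated_convergence.
Local Open Scope ereal_scope.
Context {d} {T : measurableType d} {R : realType}.
Variables (mu : {measure set T -> \bar R}) (D : set T) (mD : measurable D).

(** Dominated convergence is applied to the sequence shifted by the index [n0] from which the bound
    holds; the shift does not affect limits. *)
Lemma near_dominated_convergence (f_ : (T -> R)^nat) (f g : T -> R) :
  (forall n, measurable_fun D (f_ n)) ->
  (forall x, D x -> f_ n x @[n --> \oo] --> f x) ->
  mu.-integrable D (EFin \o g) ->
  (\forall n \near \oo, forall x, D x -> `|f_ n x| <= g x)%R ->
  mu.-integrable D (EFin \o f) /\
  \int[mu]_(x in D) (f_ n x)%:E @[n --> \oo] --> \int[mu]_(x in D) (f x)%:E.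
Proof.
move=> mf_ f_f ig [n0 _ f_g].
have mf : measurable_fun D f by exact: measurable_fun_cvg f_f.
have [|||||] := @dominated_convergence _ _ _ mu D mD
  (fun n x => (f_ (n + n0)%N x)%:E) (fun x => (f x)%:E) (fun x => (g x)%:E).
- by move=> n; exact/measurable_EFinP.
- exact/measurable_EFinP.
- apply: aeW => x Dx; apply: cvg_EFin; first exact: nearW.
  by have := f_f x Dx; rewrite -(cvg_shiftn n0).
- exact: ig.
- apply: aeW => x n Dx; rewrite lee_fin; apply: f_g => //=.
  exact: leq_addl.
- move=> i _ h; split => //.
  by rewrite -(cvg_shiftn n0).
Qed.

End near_dominated_convergence.

(** * Convergence of means through tail integrals *)

Section tail_gap.
Context {R : realType}.
Notation mu := (@lebesgue_measure R).

(* For the distribution function K of an integrable real variable this is its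
   mean. *)
Definition tail_gap (K : R -> R) : \bar R :=
  (\int[mu]_(s in `[0%R, +oo[) (1 - K s)%:E -
   \int[mu]_(s in `[0%R, +oo[) (K (- s)%R)%:E)%E.

Definition gumbel_cdf (s : R) : R := expR (- expR (- s)).

Lemma integral0y_expRN (c : R) : 0 < c ->
  (\int[mu]_(s in `[0%R, +oo[) (expR (- (c * s)))%:E = (c^-1)%:E)%E.
Proof.
move=> c0.
have dF (s : R) : is_derive s 1 (fun s => - (c^-1 * expR (- (c * s)))) (expR (- (c * s))).
  apply: is_derive_eq.
  by rewrite /GRing.scale/=; field; rewrite gt_eqF.
have cF : continuous (fun s : R => - (c^-1 * expR (- (c * s)))).
  by move=> s; apply: differentiable_continuous; apply/derivable1_diffP; have [] := dF s.
have cf : continuous (fun s : R => expR (- (c * s))).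
  move=> s; apply: continuous_comp; last exact: continuous_expR.
  by apply: cvgN; apply: cvgM; [exact: cvg_cst|exact: cvg_id].
rewrite (@ge0_continuous_FTC2y _ _ (fun s => - (c^-1 * expR (- (c * s)))) 0 0).
- by rewrite mulr0 oppr0 expR0 mulr1 sub0e EFinN oppeK.
- by move=> s _; exact: expR_ge0.
- exact: continuous_subspaceT.
- rewrite -oppr0 -(mulr0 c^-1); apply: cvgN; apply: cvgM; first exact: cvg_cst.
  apply: (@cvg_comp _ _ _ (fun s => c * s) (fun s => expR (- s)) _ (pinfty_nbhs R)).
    exact: gt0_cvgMry.
  exact: cvgr_expR.
- by move=> s _; have [] := dF s.
- by apply: cvg_at_right_filter; exact: cF.
- by move=> s _; rewrite derive1E; have [] := dF s.
Qed.

Lemma integrable_expRN (c : R) : 0 < c ->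
  mu.-integrable `[0%R, +oo[ (EFin \o (fun s => expR (- (c * s)))).
Proof.
move=> c0; apply/integrableP; split.
  apply/measurable_EFinP; apply: measurable_funTS.
  apply: continuous_measurable_fun => s.
  apply: continuous_comp; last exact: continuous_expR.
  by apply: cvgN; apply: cvgM; [exact: cvg_cst|exact: cvg_id].
under eq_integral do rewrite /= ger0_norm ?expR_ge0//.
by rewrite integral0y_expRN// ltry.
Qed.

Lemma integrable_oneDsqrV :
  mu.-integrable `[0%R, +oo[ (EFin \o (fun s : R => (1 + s ^+ 2)^-1)).
Proof.
apply/integrableP; split.
  apply/measurable_EFinP; apply: measurable_funTS.
  by apply: continuous_measurable_fun; exact: continuous_oneDsqrV.
under eq_integral do
  rewrite /= ger0_norm ?invr_ge0 ?(le_trans ler01 (oneDsqr_ge1 _))//.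
by rewrite integral0y_oneDsqr ltry.
Qed.

(** Dominated convergence on each half-line, with an exponential dominant for the right tail and a
    Cauchy one for the left. Integrability of the limits makes both integrals finite, so their
    difference in [\bar R] passes to the limit. *)
Lemma cvg_tail_gap (K : nat -> R -> R) (G : R -> R) (C : R) :
  (forall n, measurable_fun [set: R] (K n)) ->
  (forall s, K n s @[n --> \oo] --> G s) ->
  (\forall n \near \oo, forall s, 0 <= s -> 0 <= 1 - K n s <= expR (- (2^-1 * s))) ->
  (\forall n \near \oo, forall s, 0 <= s -> 0 <= K n (- s) <= C * (1 + s ^+ 2)^-1) ->
  tail_gap G \is a fin_num /\ tail_gap (K n) @[n --> \oo] --> tail_gap G.
Proof.
move=> mK KG Kp Kn.
have mD : measurable (`[0%R, +oo[%classic : set (measurableTypeR R)) by [].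
have m1 n : measurable_fun [set: R] (fun s => 1 - K n s) by exact: measurable_funB.
have [||||iG1 cG1] := @near_dominated_convergence _ _ R mu _ mD
    (fun n s => 1 - K n s) (fun s => 1 - G s) (fun s => expR (- (2^-1 * s))).
- by move=> n; apply: measurable_funTS; exact: m1.
- by move=> s _; apply: cvgB => //; exact: cvg_cst.
- by apply: integrable_expRN; rewrite invr_gt0.
- near=> n => s /=; rewrite in_itv/= andbT => s0.
  have /andP[h1 h2] : 0 <= 1 - K n s <= expR (- (2^-1 * s)) by move: s s0; near: n.
  by rewrite ger0_norm.
have [||||iG2 cG2] := @near_dominated_convergence _ _ R mu _ mD
    (fun n s => K n (- s)) (fun s => G (- s)) (fun s => C * (1 + s ^+ 2)^-1).
- move=> n; apply: measurable_funTS; apply: measurableT_comp => //.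
- by move=> s _.
- by apply: (@integrableZl _ _ R mu _ _ C _ integrable_oneDsqrV).
- near=> n => s /=; rewrite in_itv/= andbT => s0.
  have /andP[h1 h2] : 0 <= K n (- s) <= C * (1 + s ^+ 2)^-1 by move: s s0; near: n.
  by rewrite ger0_norm.
have f1 := integrable_fin_num mD iG1; have f2 := integrable_fin_num mD iG2.
split; first by rewrite fin_numB f1.
by apply: cvgeB => //; exact: fin_num_adde_defr.
Unshelve. all: by end_near. Qed.

End tail_gap.

(** * Maxima of exponential variables and the mean of the Gumbel law *)

Section exponential_maxima.
Context {R : realType}.
Notation mu := (@lebesgue_measure R).

(** Termwise primitive in the geometric sum [1 - u ^+ n = (1 - u) * \sum_(k < n) u ^+ k] with
    [u = 1 - expR (- t)]. It vanishes at [0] and tends to the harmonic number at infinity. *)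
Definition max_exp_primitive n (t : R) : R :=
  \sum_(1 <= k < n.+1) (1 - expR (- t)) ^+ k / k%:R.

Lemma is_derive_max_exp_primitive n (t : R) :
  is_derive t 1 (max_exp_primitive n) (1 - (1 - expR (- t)) ^+ n).
Proof.
elim: n => [|n ih].
  rewrite expr0 subrr (_ : max_exp_primitive 0 = cst 0); first exact: is_derive_cst.
  by apply/funext => u; rewrite /max_exp_primitive big_geq.
have -> : max_exp_primitive n.+1 =
    max_exp_primitive n + (fun t => (n.+1%:R)^-1 * ((fun t => 1 - expR (- t)) ^+ n.+1) t).
  apply/funext => u; rewrite /max_exp_primitive big_nat_recr//=.
  by rewrite exprfctE mulrC.
apply: is_derive_eq.
rewrite /GRing.scale/= add0r mul1r mulrN1 opprK -mulrA mulKf ?pnatr_eq0// exprS.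
ring.
Qed.

Lemma max_exp_primitive0 n : max_exp_primitive n 0 = 0.
Proof.
rewrite /max_exp_primitive big_nat_cond big1// => k /andP[/andP[k1 _] _].
by rewrite oppr0 expR0 subrr expr0n gtn_eqF// mul0r.
Qed.

Lemma cvg_max_exp_primitive n : max_exp_primitive n t @[t --> +oo] -->
  (\sum_(1 <= k < n.+1) (k%:R)^-1 : R).
Proof.
elim: n => [|n ih].
  rewrite big_geq// (_ : max_exp_primitive 0 = cst 0); first exact: cvg_cst.
  by apply/funext => u; rewrite /max_exp_primitive big_geq.
rewrite big_nat_recr//= (_ : max_exp_primitive n.+1 = fun t =>
    max_exp_primitive n t + (1 - expR (- t)) ^+ n.+1 / n.+1%:R); last first.
  by apply/funext => u; rewrite /max_exp_primitive big_nat_recr.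
have h : (1 - expR (- t) : R) @[t --> +oo] --> (1 : R).
  by rewrite -[X in _ --> X]subr0; apply: cvgB; [exact: cvg_cst|exact: cvgr_expR].
apply: cvgD => //; rewrite -[X in _ --> X]mul1r; apply: cvgM; last exact: cvg_cst.
rewrite -[X in _ --> X](expr1n _ n.+1).
exact: (cvg_comp _ _ h (@exprn_continuous _ _ _)).
Qed.

(* Distribution function of the maximum of n independent exponential variables
   of mean 1, recentred at ln n. *)
Definition max_exp_cdf n (s : R) : R :=
  (1 - Num.min 1 (expR (- (ln n%:R + s)))) ^+ n.

Lemma max_exp_cdfE n (s : R) : 0 <= ln n%:R + s ->
  max_exp_cdf n s = (1 - expR (- (ln n%:R + s))) ^+ n.
Proof.
by move=> h; rewrite /max_exp_cdf min_r// -[leRHS]expR0 ler_expR oppr_le0.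
Qed.

Lemma continuous_max_exp_cdf n : continuous (max_exp_cdf n).
Proof.
move=> s.
apply: (@continuous_comp _ _ _ (fun s => 1 - Num.min 1 (expR (- (ln n%:R + s))))
  (fun u => u ^+ n)); last exact: exprn_continuous.
apply: cvgB; first exact: cvg_cst.
apply: (@continuous_min _ _ (cst 1) (fun s => expR (- (ln n%:R + s)))).
  exact: cvg_cst.
apply: continuous_comp; last exact: continuous_expR.
by apply: cvgN; apply: cvgD; [exact: cvg_cst|exact: cvg_id].
Qed.

(** With [l = ln n] and [M] the primitive above, the right integral is [H_n - M l] and the left one
    is [l - M l]; [M l] cancels. [1 < n] makes [l] positive. *)
Lemma tail_gap_max_exp n : (1 < n)%N ->
  tail_gap (max_exp_cdf n) = (\sum_(1 <= k < n.+1) k%:R^-1 - ln n%:R)%:E.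
Proof.
move=> n1; set l := ln n%:R.
have l0 : 0 < l by apply: ln_gt0; rewrite ltr1n.
have n0 : n != 0%N by rewrite -lt0n ltnW.
have dP t := is_derive_max_exp_primitive n t.
have cP : continuous (max_exp_primitive n).
  by move=> s; apply: differentiable_continuous; apply/derivable1_diffP; have [] := dP s.
have cK := continuous_max_exp_cdf n.
have dP1 (s : R) : is_derive s 1 (fun s => max_exp_primitive n (l + s))
    (1 - (1 - expR (- (l + s))) ^+ n).
  have := @is_derive1_comp _ (max_exp_primitive n) (fun s => l + s) s _ 1 (dP (l + s)).
  rewrite mulr1; apply.
  by have := is_deriveD (is_derive_cst l s 1) (is_derive_id s 1); rewrite add0r.
have cP1 : continuous (fun s => max_exp_primitive n (l + s)).
  by move=> s; apply: differentiable_continuous; apply/derivable1_diffP; have [] := dP1 s.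
have dP2 (s : R) : is_derive s 1 (fun s => s + max_exp_primitive n (l - s))
    ((1 - expR (- (l - s))) ^+ n).
  have h : is_derive s 1 (fun s => max_exp_primitive n (l - s))
      ((1 - (1 - expR (- (l - s))) ^+ n) * -1).
    apply: (@is_derive1_comp _ (max_exp_primitive n) (fun s => l - s) s _ (-1) (dP (l - s))).
    by have := is_deriveB (is_derive_cst l s 1) (is_derive_id s 1); rewrite sub0r.
  by apply: is_derive_eq; ring.
have I1 : (\int[mu]_(s in `[0%R, +oo[) (1 - max_exp_cdf n s)%:E =
    (\sum_(1 <= k < n.+1) k%:R^-1)%:E - (max_exp_primitive n l)%:E)%E.
  rewrite (@ge0_continuous_FTC2y _ _ (fun s => max_exp_primitive n (l + s)) 0
     (\sum_(1 <= k < n.+1) k%:R^-1)).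
  - by rewrite addr0.
  - move=> s s0; rewrite subr_ge0 max_exp_cdfE; last by rewrite addr_ge0// ltW.
    rewrite exprn_ile1// ?lerBlDr ?lerDl ?expR_ge0// subr_ge0 expR_le1.
    by rewrite oppr_le0 addr_ge0// ltW.
  - by apply: continuous_subspaceT => s; apply: cvgB; [exact: cvg_cst|exact: cK].
  - apply: (@cvg_comp _ _ _ (fun s => l + s) _ _ (pinfty_nbhs R)).
      exact: cvg_addrl.
    exact: cvg_max_exp_primitive.
  - by move=> s _; have [] := dP1 s.
  - by apply: cvg_at_right_filter; exact: cP1.
  - move=> s; rewrite in_itv/= andbT => s0; rewrite derive1E.
    have [_ ->] := dP1 s; rewrite max_exp_cdfE// addr_ge0// ltW//.
have I2 : (\int[mu]_(s in `[0%R, +oo[) (max_exp_cdf n (- s)%R)%:E =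
    l%:E - (max_exp_primitive n l)%:E)%E.
  (* For [s > l] the minimum in [max_exp_cdf n (- s)] is [1], so the integrand is [0 ^+ n = 0]. *)
  transitivity (\int[mu]_(s in `[0%R, l]) (max_exp_cdf n (- s)%R)%:E)%E.
    rewrite [LHS]integral_mkcond [RHS]integral_mkcond; apply: eq_integral => s _.
    rewrite !patchE; case: ifPn; case: ifPn => //.
      rewrite !inE/= !in_itv/= andbT => /negP h s0.
      rewrite /max_exp_cdf min_l ?subrr ?expr0n ?(negbTE n0)//.
      have ls : l < s.
        by rewrite ltNge; apply/negP => sl; apply: h; rewrite inE/= in_itv/= s0.
      rewrite -[leLHS]expR0 ler_expR -/l; lra.
    by rewrite inE/= in_itv/= => /andP[s0 _]; rewrite mem_set//= in_itv/= s0.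
  have cKN : continuous (fun s => max_exp_cdf n (- s)).
    by move=> s; apply: continuous_comp; [exact: opp_continuous|exact: cK].
  have cP2 : continuous (fun s => s + max_exp_primitive n (l - s)).
    by move=> s; apply: differentiable_continuous; apply/derivable1_diffP; have [] := dP2 s.
  rewrite (@continuous_FTC2 _ _ (fun s => s + max_exp_primitive n (l - s)))//.
  - by rewrite subrr max_exp_primitive0 addr0 subr0 add0r.
  - exact: continuous_subspaceT.
  - split; first by move=> s _; have [] := dP2 s.
      by apply: cvg_at_right_filter; exact: cP2.
    by apply: cvg_at_left_filter; exact: cP2.
  - move=> s; rewrite in_itv/= => /andP[s0 sl]; rewrite derive1E.
    by have [_ ->] := dP2 s; rewrite max_exp_cdfE// subr_ge0 ltW.
rewrite /tail_gap I1 I2 -!EFinB; congr EFin; ring.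
Qed.

(** As soon as the minimum is not [1], [n] times the individual tail is exactly [expR (- s)], so the
    power tends to the Gumbel distribution function. *)
Lemma cvg_tail_gap_max_exp : tail_gap (@gumbel_cdf R) \is a fin_num /\
  tail_gap (max_exp_cdf n) @[n --> \oo] --> tail_gap (@gumbel_cdf R).
Proof.
have q01 n (s : R) : 0 <= Num.min 1 (expR (- (ln n%:R + s))) <= 1.
  by rewrite le_min ler01 expR_ge0/= ge_min lexx.
have nq n (s : R) : (0 < n)%N -> n%:R * expR (- (ln n%:R + s)) = expR (- s).
  by move=> n0; rewrite opprD expRD [expR (- ln _)]expRN lnK ?posrE ?ltr0n// mulVKf// pnatr_eq0 -lt0n.
(* The left tail is at most [expR (- expR s)], and [expR (expR s) >= 1 + expR s >= 2 + s ^+ 2 / 2];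
   this allows the constant [2]. *)
apply: (@cvg_tail_gap _ _ _ 2).
- by move=> n; apply: continuous_measurable_fun; exact: continuous_max_exp_cdf.
- move=> s; apply: cvg_expr_expRN => [n|]; first exact: q01.
  apply: cvg_near_cst; near=> n.
  rewrite min_r ?nq//; first by near: n; exact: nbhs_infty_gt.
  rewrite -(@ler_pM2l _ n%:R) ?nq ?mulr1 ?ltr0n//; near: n.
  - exact: nbhs_infty_ger.
  - exact: nbhs_infty_gt.
  - exact: nbhs_infty_gt.
- near=> n => s s0.
  have n0 : (0 < n)%N by near: n; exact: nbhs_infty_gt.
  have /andP[q0 q1] := q01 n s.
  rewrite subr_ge0 exprn_ile1//=; try lra.
  apply: le_trans (one_minus_exprn_le _ n (q01 n s)) _.
  apply: (@le_trans _ _ (expR (- s))); last by rewrite ler_expR; lra.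
  by rewrite -(nq n s)// ler_wpM2l// ge_min lexx orbT.
- near=> n => s s0.
  have n0 : (0 < n)%N by near: n; exact: nbhs_infty_gt.
  have /andP[q0 q1] := q01 n (- s).
  rewrite exprn_ge0/=; last lra.
  have [le|lt] := leP (expR (- (ln n%:R - s))) 1; last first.
    rewrite /max_exp_cdf min_l ?(ltW lt)// subrr expr0n gtn_eqF//.
    by rewrite mulr_ge0// invr_ge0 addr_ge0// sqr_ge0.
  rewrite /max_exp_cdf min_r//; apply: le_trans (exprn_le_expRN _ _ le) _.
  rewrite nq// opprK expRN ler_pdivlMr; last by rewrite ltr_pwDl// sqr_ge0.
  rewrite mulrC ler_pdivrMr ?expR_gt0//.
  have := expR_ge1Dx (expR s); have := @expR_ge1Dxn _ s 1 s0.
  rewrite (_ : 2`!%:R = 2)//; lra.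
Unshelve. all: by end_near. Qed.

(** The limit of the recentred means also shows that the sequence under [limn] converges, so
    [euler_constant] is a genuine limit and not a default value. *)
Lemma tail_gap_gumbel : tail_gap (@gumbel_cdf R) = (euler_constant R)%:E.
Proof.
have [fG cG] := cvg_tail_gap_max_exp.
have : (\sum_(1 <= k < n.+1) k%:R^-1 - ln n%:R : R) @[n --> \oo] -->
    fine (tail_gap (@gumbel_cdf R)).
  have : (\sum_(1 <= k < n.+1) k%:R^-1 - ln n%:R : R)%:E @[n --> \oo] -->
      (fine (tail_gap (@gumbel_cdf R)))%:E.
    rewrite fineK//; apply: cvg_trans cG; apply: near_eq_cvg; near=> n.
    by apply: tail_gap_max_exp; near: n; exact: nbhs_infty_gt.
  by move=> /fine_cvgP[].
by move=> /cvg_lim h; rewrite /euler_constant h// fineK.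
Unshelve. all: by end_near. Qed.

End exponential_maxima.

(** * Gumbel limit and convergence of means for the normalised maximum *)

Section normalised_maximum.
Context {R : realType}.
Variables (L : R -> R) (beta : R).
Hypothesis beta_gt0 : 0 < beta.
Hypothesis L0 : L 0 = 0.
Hypothesis L_ge : forall x y : R, 0 <= x -> x <= y -> beta * (y - x) <= L y - L x.
Hypothesis L_le : forall x y : R, 0 < x -> x <= y -> L y - L x <= (y - x) * (L x / x).
Hypothesis cvg_L_ratio : L x / x @[x --> +oo] --> beta.
Variables (x z : nat -> R).
Hypothesis x_ge0 : \forall n \near \oo, 0 <= x n.
Hypothesis z_ge0 : \forall n \near \oo, 0 <= z n.
Hypothesis Lx : \forall n \near \oo, L (x n) = ln n%:R.
Hypothesis Lz : \forall n \near \oo, L (z n) = ln n%:R + 1.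

Let b n := ln ((1 + z n) / (1 + x n)).
Let y n s := (1 + x n) * expR (b n * s) - 1.
(** The value [1] below level [0] makes [(1 - q n s) ^+ n] vanish there for [n > 0], as the
    distribution function of a nonnegative maximum must. *)
Let q n (s : R) : R := if 0 <= y n s then expR (- L (y n s)) else 1.

Let L_ge0 u : 0 <= u -> 0 <= L u.
Proof.
move=> u0; have := L_ge _ _ (lexx _) u0; rewrite L0 !subr0; apply: le_trans.
by rewrite mulr_ge0// ltW.
Qed.

Let q01 n s : 0 <= q n s <= 1.
Proof.
rewrite /q; case: ifPn => [y0|_]; last by rewrite ler01 lexx.
by rewrite expR_ge0 expR_le1 oppr_le0 L_ge0.
Qed.

Let nqE n s : (0 < n)%N -> L (x n) = ln n%:R -> 0 <= y n s ->
  n%:R * q n s = expR (- (L (y n s) - L (x n))).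
Proof.
move=> n0 Lxn y0; rewrite /q y0 opprB Lxn expRD lnK ?posrE ?ltr0n//.
Qed.

(* 24 = 4! comes from bounding expR D below by its Taylor term of degree 4. *)
Let left_tail_bound (w D t : R) : 0 <= D -> t ^+ 2 / 4 <= (1 + w * t) * D ^+ 2 ->
  0 <= w -> 0 <= t ->
  expR (- expR D) <= (2 + 24 * (32 * (1 + w ^+ 2))) * (1 + t ^+ 2)^-1.
Proof.
move=> D0 tD w0 t0.
have t2 : 0 < 1 + t ^+ 2 by rewrite ltr_pwDl// sqr_ge0.
have D4 : 0 <= D ^+ 4 by rewrite exprn_ge0.
have wt : (1 + w * t) ^+ 2 <= 2 * (1 + w ^+ 2) * (1 + t ^+ 2).
  have := sqr_ge0 (1 - w * t); have := sqr_ge0 w; have := sqr_ge0 t.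
  by rewrite sqrrB sqrrD expr1n !mul1r exprMn; lra.
have : (t ^+ 2 / 4) ^+ 2 <= ((1 + w * t) * D ^+ 2) ^+ 2.
  by rewrite lerXn2r ?nnegrE ?divr_ge0 ?mulr_ge0 ?addr_ge0 ?mulr_ge0 ?sqr_ge0.
rewrite [leRHS]exprMn -exprM => h.
have {}h : (t ^+ 2 / 4) ^+ 2 <= 2 * (1 + w ^+ 2) * (1 + t ^+ 2) * D ^+ 4.
  by apply: le_trans h _; rewrite ler_wpM2r.
(* Write [t ^+ 4 = (t ^+ 2 - 1) * (1 + t ^+ 2) + 1], drop the final [1] and divide by [1 + t ^+ 2];
   the factor is [32 = 16 * 2]. *)
have {}h : t ^+ 2 - 1 <= 32 * (1 + w ^+ 2) * D ^+ 4.
  rewrite -(ler_pM2r t2); move: h.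
  have -> : (t ^+ 2 / 4) ^+ 2 = ((t ^+ 2 - 1) * (1 + t ^+ 2) + 1) / 16 by field.
  lra.
have e1 : 1 + D ^+ 4 / 24 <= expR D.
  by have := @expR_ge1Dxn _ D 3 D0; rewrite (_ : 4`!%:R = 24).
have := expR_ge1Dx (expR D).
rewrite expRN ler_pdivlMr// mulrC ler_pdivrMr ?expR_gt0// => e2.
have ww : 0 <= w ^+ 2 by exact: sqr_ge0.
apply: (@le_trans _ _ ((2 + 24 * (32 * (1 + w ^+ 2))) * (1 + D ^+ 4 / 24))).
  have : 0 <= (1 + w ^+ 2) by lra.
  lra.
by rewrite ler_wpM2l//; lra.
Qed.

Lemma cvg_tail_gap_max (K : nat -> R -> R) :
  (forall n, measurable_fun [set: R] (K n)) ->
  (\forall n \near \oo, forall s, K n s = (1 - q n s) ^+ n) ->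
  tail_gap (K n) @[n --> \oo] --> (euler_constant R)%:E.
Proof.
move=> mK KE; rewrite -tail_gap_gumbel.
(* The constant is that of [left_tail_bound] at [w = 4 / beta], the coefficient in
   [hazard_increment_sqr_ge]. *)
apply: (cvg_tail_gap K _ (2 + 24 * (32 * (1 + (4 / beta) ^+ 2))) mK _ _ _).2.
- move=> s.
  have h : (1 - q n s) ^+ n @[n --> \oo] --> gumbel_cdf s.
    apply: cvg_expr_expRN => [n|]; first exact: q01.
    have h : expR (- (L (y n s) - L (x n))) @[n --> \oo] --> expR (- s).
      have h : - (L (y n s) - L (x n)) @[n --> \oo] --> - s.
        by apply: cvgN;
          exact: (hazard_increment_cvg L beta beta_gt0 L0 L_ge L_le cvg_L_ratio).
      exact: (cvg_comp _ _ h (@continuous_expR R _)).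
    apply: cvg_trans h; apply: near_eq_cvg; near=> n.
    rewrite nqE//; near: n; [exact: nbhs_infty_gt|exact: Lx|].
    have := shifted_quantile_pinfty L beta beta_gt0 L0 L_ge L_le cvg_L_ratio x z
      x_ge0 z_ge0 Lx Lz s.
    by move=> /cvgryPge; exact.
  apply: cvg_trans h; apply: near_eq_cvg; near=> n.
  have : forall s, K n s = (1 - q n s) ^+ n by near: n.
  by move=> ->.
- near=> n => s s0.
  have -> : K n s = (1 - q n s) ^+ n.
    by move: s {s0}; near: n.
  have /andP[q0 q1] := q01 n s.
  rewrite subr_ge0 exprn_ile1/= ?subr_ge0//; last by rewrite lerBlDr lerDl.
  apply: le_trans (one_minus_exprn_le _ n (q01 n s)) _.
  have x0 : 0 <= x n by near: n.
  have b0 : 0 <= b n.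
    near: n; exact: (quantile_gap_ge0 L beta beta_gt0 L0 L_ge L_le).
  rewrite nqE//.
  + rewrite ler_expR lerN2 mulrC; move: s s0 {q0 q1}; near: n.
    exact: (hazard_increment_ge L beta beta_gt0 L0 L_ge L_le cvg_L_ratio).
  + by near: n; exact: nbhs_infty_gt.
  + by near: n.
  + have e1 : 1 <= expR (b n * s) by rewrite -expR0 ler_expR mulr_ge0.
    have := ler_pM ler01 ler01 (_ : 1 <= 1 + x n) e1; rewrite mulr1 /y => h.
    by rewrite subr_ge0 h//; lra.
- near=> n => t t0.
  have -> : K n (- t) = (1 - q n (- t)) ^+ n.
    by move: (- t); near: n.
  have n0 : (0 < n)%N by near: n; exact: nbhs_infty_gt.
  have /andP[q0 q1] := q01 n (- t).
  rewrite exprn_ge0 ?subr_ge0//=.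
  have [y0|y0] := leP 0 (y n (- t)); last first.
    rewrite /q [0 <= y n _]leNgt y0/= subrr expr0n gtn_eqF//.
    rewrite mulr_ge0// ?invr_ge0 ?addr_ge0 ?sqr_ge0//.
    by have := sqr_ge0 (4 / beta); lra.
  apply: le_trans (exprn_le_expRN _ _ q1) _.
  rewrite nqE//; last by near: n.
  have [D0 D1] : 0 <= L (x n) - L (y n (- t)) /\
      t ^+ 2 / 4 <= (1 + 4 / beta * t) * (L (x n) - L (y n (- t))) ^+ 2.
    move: t t0 y0 {q0 q1}; near: n.
    exact: (hazard_increment_sqr_ge L beta beta_gt0 L0 L_ge L_le cvg_L_ratio).
  by rewrite opprB; apply: left_tail_bound => //; rewrite divr_ge0// ltW.
Unshelve. all: by end_near. Qed.

End normalised_maximum.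

(** * Expectations as tail integrals *)

Section expectation_tail_gap.
Local Open Scope ereal_scope.
Context {d} {T : measurableType d} {R : realType} (P : probability T R).
Notation mu := (@lebesgue_measure R).

Lemma expectation_tail_gap (X : {RV P >-> R}) : (X : T -> R) \in Lfun P 1 ->
  'E_P[X] = tail_gap (fun s => fine (cdf X s)).
Proof.
move=> X1; rewrite expectation_cdf_ccdf//.
rewrite /tail_gap; congr (_ - _).
  apply: eq_integral => s _.
  by rewrite ccdf_1_cdf EFinB fineK// fin_num_measure.
have mF : measurable_fun [set: R] (fun s : R => cdf X (- s)%R).
  by apply: (measurableT_comp (cdf_measurable X)).
transitivity (\int[mu]_(s in `[0%R, +oo[) cdf X (- s)%R); last first.
  by apply: eq_integral => s _; rewrite fineK// fin_num_measure.
(* The reflection [s -> - s] yields the half-line closed at [0]; the endpoint is Lebesgue-null. *)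
rewrite ge0_integration_by_substitution0//.
under [RHS]eq_integral do rewrite opprK.
rewrite integral_itv_bndo_bndc//.
by apply: measurable_funTS; exact: cdf_measurable.
Qed.

(** The mean of a nonnegative variable is the integral of its survival function. This is how
    integrability of [Rmax N] follows from its law. *)
Lemma Lfun1_exponential_tail (X : {RV P >-> R}) (C c : R) : (0 < c)%R ->
  (forall w, 0 <= X w)%R ->
  (forall r, (0 <= r)%R -> ccdf X r <= (C * expR (- (c * r)))%:E) ->
  (X : T -> R) \in Lfun P 1.
Proof.
move=> c0 X0 Xtail; apply/Lfun1_integrable/integrableP; split.
  exact/measurable_EFinP.
under eq_integral do rewrite /= ger0_norm//.
rewrite -expectation_def ge0_expectation_ccdf//.
have iC : mu.-integrable `[0%R, +oo[ (fun s => C%:E * (expR (- (c * s)))%:E).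
  by apply: (@integrableZl _ _ R mu _ _ C _ (integrable_expRN c c0)).
have /integrableP[_] := iC; apply: le_lt_trans.
apply: ge0_le_integral => //.
- by apply: measurable_funTS; exact: ccdf_measurable.
- by have /integrableP[h _] := iC; exact: measurableT_comp.
- move=> r /=; rewrite in_itv/= andbT => r0.
  by apply: le_trans (Xtail _ r0) _; rewrite lee_fin ler_norm.
Qed.

Lemma expectation_standardise (X : {RV P >-> R}) (a b : R) : (0 < b)%R ->
  (X : T -> R) \in Lfun P 1 ->
  ('E_P[X] - a%:E) / b%:E = tail_gap (fun s => fine (cdf X (a + b * s)%R)).
Proof.
move=> b0 X1.
pose Y : {RV P >-> R} := ((X - cst a) * cst b^-1)%R.
have YE : (Y : T -> R) = (b^-1 \o* (X \- cst a))%R by [].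
have Xa1 : (X \- cst a : T -> R)%R \in Lfun P 1 by rewrite rpredB// Lfun_cst.
have Y1 : (Y : T -> R) \in Lfun P 1 by rewrite YE Lfun_scale.
have := expectation_tail_gap Y Y1.
rewrite YE expectationZl// expectationB ?Lfun_cst// expectation_cst.
rewrite inver gt_eqF// muleC => ->; congr tail_gap; apply/funext => s.
congr (fine (P _)); apply/seteqP; split => w /=; rewrite !in_itv/=.
  by rewrite ler_pdivrMr// lerBlDl mulrC.
by rewrite ler_pdivrMr// lerBlDl mulrC.
Qed.

End expectation_tail_gap.

(** * Hazard of a Laplace transform *)

Section laplace_transform.
Context {d} {T : measurableType d} {R : realType} (P : probability T R).
Variables (W : T -> R) (beta : R).
Hypothesis mW : measurable_fun [set: T] W.
Hypothesis beta_gt0 : 0 < beta.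
Hypothesis W_ge : forall w, beta <= W w.
Hypothesis W_essinf : forall e : R, 0 < e -> (0 < P [set w | (W w <= beta + e)%R])%E.

Definition laplace (x : R) : R := (\int[P]_w expR (- (x * W w)))%R.

Definition hazard (x : R) : R := - ln (laplace x).

Let mexp x : measurable_fun [set: T] (fun w => expR (- (x * W w))).
Proof.
apply: measurableT_comp => //; apply: measurableT_comp => //.
exact: measurable_funM.
Qed.

Let W_ge0 w : 0 <= W w. Proof. exact: le_trans (ltW beta_gt0) (W_ge w). Qed.

Let icst (c : R) : P.-integrable setT (EFin \o cst c).
Proof. exact: finite_measure_integrable_cst. Qed.

Lemma laplace_integrable (x : R) : 0 <= x -> P.-integrable setT (EFin \o (fun w => expR (- (x * W w)))).
Proof.
move=> x0; apply: (@le_integrable _ _ _ P _ measurableT _ (EFin \o cst 1) _ _ (icst 1)).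
  exact/measurable_EFinP.
move=> w _ /=; rewrite lee_fin normr1 ger0_norm ?expR_ge0//.
by rewrite expR_le1 oppr_le0 mulr_ge0.
Qed.

Let Rint_cst (c : R) : (\int[P]_w c = c)%R.
Proof.
rewrite Rintegral_cst// -[RHS]mulr1; congr (_ * _).
by rewrite (_ : _ setT = 1%E)//; exact: probability_setT.
Qed.

Lemma laplace0 : laplace 0 = 1.
Proof.
rewrite /laplace -[RHS]Rint_cst; apply: eq_Rintegral => w _.
by rewrite mul0r oppr0 expR0.
Qed.

(** Only the event [W <= beta + e] is kept in the integral. It has positive probability, which
    yields positivity of [laplace] and the limit of [hazard x / x]. *)
Lemma laplace_ge (x e : R) : 0 <= x -> 0 < e ->
  expR (- (x * (beta + e))) * fine (P [set w | W w <= beta + e]) <= laplace x.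
Proof.
move=> x0 e0; set A := [set w | _].
have mA : measurable A.
  rewrite /A -[X in measurable X]setTI; apply: measurable_fun_le => //.
rewrite -(Rintegral_cst P mA) Rintegral_mkcond; apply: le_Rintegral => //.
- rewrite -restrict_EFin; apply/integrable_restrict => //.
  by rewrite setTI; apply: integrableS (icst _).
- exact: laplace_integrable.
- move=> w _; rewrite patchE; case: ifPn; last by rewrite expR_ge0.
  by rewrite inE /A/= => Ww; rewrite ler_expR lerN2 ler_wpM2l.
Qed.

Lemma laplace_gt0 (x : R) : 0 <= x -> 0 < laplace x.
Proof.
move=> x0; apply: lt_le_trans (laplace_ge x 1 x0 ltr01).
rewrite mulr_gt0 ?expR_gt0// fine_gt0// W_essinf//=.
by rewrite (le_lt_trans (probability_le1 _ _))// ?ltry//;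
   rewrite -[X in measurable X]setTI; exact: measurable_fun_le.
Qed.

Lemma hazard0 : hazard 0 = 0.
Proof. by rewrite /hazard laplace0 ln1 oppr0. Qed.

Lemma expR_hazard (x : R) : 0 <= x -> expR (- hazard x) = laplace x.
Proof. by move=> x0; rewrite opprK lnK// posrE laplace_gt0. Qed.

(** Integrates the pointwise bound [expR (- (y * W)) <= expR (- (beta * (y - x))) * expR (- (x *
    W))]. *)
Lemma hazard_increment_lower (x y : R) : 0 <= x -> x <= y ->
  beta * (y - x) <= hazard y - hazard x.
Proof.
move=> x0 xy; have y0 : 0 <= y by exact: le_trans xy.
suff h : laplace y <= expR (- (beta * (y - x))) * laplace x.
  have : ln (laplace y) <= - (beta * (y - x)) + ln (laplace x).
    rewrite -[X in X + _]expRK -lnM ?posrE ?expR_gt0 ?laplace_gt0//.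
    by rewrite ler_ln// posrE ?mulr_gt0 ?expR_gt0 ?laplace_gt0.
  by rewrite /hazard; lra.
rewrite /laplace -RintegralZl//; last exact: laplace_integrable.
apply: le_Rintegral => //; first exact: laplace_integrable.
- under [X in _.-integrable _ X]eq_fun do rewrite /= EFinM.
  by apply: integrableZl => //; exact: laplace_integrable.
- move=> w _; rewrite -expRD ler_expR.
  have : beta * (y - x) <= W w * (y - x) by rewrite ler_wpM2r// subr_ge0.
  lra.
Qed.

(** Bernoulli's inequality for the real power [p] of [expR z]: the power function lies above its
    tangent at [1]. *)
Let expR_bernoulli (p z : R) : 1 <= p -> 1 + p * (expR z - 1) <= expR (p * z).
Proof.
move=> p1.
have h1 : expR z - 1 <= expR z * z.
  have := expR_ge1Dx (- z); rewrite expRN => h.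
  have : expR z * (1 - z) <= expR z * (expR z)^-1 by rewrite ler_pM2l ?expR_gt0.
  by rewrite mulfV ?gt_eqF ?expR_gt0//; lra.
have h2 : expR z * (1 + (p - 1) * z) <= expR (p * z).
  have -> : p * z = z + (p - 1) * z by ring.
  by rewrite expRD ler_pM2l ?expR_gt0// expR_ge1Dx.
apply: le_trans h2.
have : (p - 1) * (expR z - 1) <= (p - 1) * (expR z * z) by rewrite ler_wpM2l//; lra.
lra.
Qed.

(* Jensen's inequality laplace x ^ (y / x) <= laplace y, integrating the
   tangent line of the power function at laplace x. *)
Lemma hazard_increment_upper (x y : R) : 0 < x -> x <= y ->
  hazard y - hazard x <= (y - x) * (hazard x / x).
Proof.
move=> x0 xy; have y0 : 0 <= y by exact: le_trans (ltW x0) xy.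
pose p := y / x; pose c := hazard x.
have p1 : 1 <= p by rewrite ler_pdivlMr// mul1r.
suff h : expR (- (p * c)) <= laplace y.
  have : - (p * c) <= ln (laplace y).
    by rewrite -[leLHS]expRK ler_ln// posrE ?expR_gt0 ?laplace_gt0.
  have -> : (y - x) * (hazard x / x) = p * c - c by rewrite /p /c; field; rewrite gt_eqF.
  by rewrite -/c {1}/hazard; lra.
(* [A + B * u] is the tangent line of [u -> u ^ p] at [u = expR (- c) = laplace x], where its value
   is [expR (- (p * c))]. *)
pose A := expR (- (p * c)) * (1 - p); pose B := expR (- (p * c)) * (p * expR c).
have -> : expR (- (p * c)) = (\int[P]_w (A + B * expR (- (x * W w))))%R.
  rewrite RintegralD//; last 2 first.
  - exact: icst.
  - exact: (@integrableZl _ _ _ P _ measurableT B _ (laplace_integrable _ (ltW x0))).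
  rewrite Rint_cst RintegralZl//; last by apply: laplace_integrable; exact: ltW.
  rewrite -/(laplace x) -(expR_hazard _ (ltW x0)) -/c /A /B.
  have -> : forall u v : R, u * (1 - p) + u * (p * expR c) * v =
     u * (1 - p) + u * p * (expR c * v) by move=> u v; ring.
  by rewrite -expRD subrr expR0; ring.
apply: le_Rintegral => //; last 2 first.
- exact: laplace_integrable.
- move=> w _.
  have -> : - (y * W w) = - (p * c) + p * (c - x * W w).
    by rewrite /p; field; rewrite gt_eqF.
  rewrite expRD; apply: le_trans (_ : expR (- (p * c)) * (1 + p * (expR (c - x * W w) - 1)) <= _).
    by rewrite expRD /A /B le_eqVlt; apply/orP; left; apply/eqP; ring.
  by rewrite ler_pM2l ?expR_gt0// expR_bernoulli.
exact: (integrableD measurableT (icst A)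
  (@integrableZl _ _ _ P _ measurableT B _ (laplace_integrable _ (ltW x0)))).
Qed.

(** [laplace_ge] with [e / 2] gives [hazard x <= x * (beta + e / 2) - ln p], and [- ln p] is at most
    [x * (e / 2)] for large [x]. *)
Lemma cvg_hazard_ratio : hazard x / x @[x --> +oo] --> beta.
Proof.
apply/cvgrPdist_le => e e0.
have e20 : 0 < e / 2 by rewrite divr_gt0.
set p := fine (P [set w | W w <= beta + e / 2]).
have p0 : 0 < p.
  rewrite fine_gt0// W_essinf//=.
  by rewrite (le_lt_trans (probability_le1 _ _))// ?ltry//;
    rewrite -[X in measurable X]setTI; exact: measurable_fun_le.
near=> x.
have x0 : 0 < x by near: x; exact: nbhs_pinfty_gt.
have xp : - ln p / (e / 2) <= x by near: x; apply: nbhs_pinfty_ge; rewrite num_real.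
have h1 : beta * x <= hazard x.
  by have := hazard_increment_lower 0 x (lexx _) (ltW x0); rewrite hazard0 !subr0.
have h2 : hazard x <= x * (beta + e / 2) - ln p.
  have := laplace_ge x _ (ltW x0) e20; rewrite -/p => h.
  have : ln (expR (- (x * (beta + e / 2))) * p) <= ln (laplace x).
    by rewrite ler_ln// posrE ?mulr_gt0 ?expR_gt0 ?laplace_gt0// ltW.
  by rewrite lnM ?posrE ?expR_gt0// expRK /hazard; lra.
have h3 : - ln p <= x * (e / 2) by rewrite -ler_pdivrMr.
have h4 : beta <= hazard x / x by rewrite ler_pdivlMr.
rewrite distrC ger0_norm ?subr_ge0// lerBlDl ler_pdivrMr//; lra.
Unshelve. all: by end_near. Qed.

End laplace_transform.

(** * Joint laws, independence and conditioning *)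

Section joint_law.
Local Open Scope ereal_scope.
Context {d d1 d2} {T : measurableType d} {T1 : measurableType d1}
  {T2 : measurableType d2} {R : realType}.

(** Uniqueness of the product measure from its values on rectangles. [m] need not have mass [1], so
    that [P] restricted to an event can be used. *)
Lemma pair_law (m : {measure set T -> \bar R})
    (m1 : {sigma_finite_measure set T1 -> \bar R})
    (m2 : {sigma_finite_measure set T2 -> \bar R}) (X : T -> T1) (Y : T -> T2) :
  measurable_fun [set: T] X -> measurable_fun [set: T] Y ->
  (forall A B, measurable A -> measurable B ->
    m (X @^-1` A `&` Y @^-1` B) = m1 A * m2 B) ->
  forall D, measurable D -> m ((fun w => (X w, Y w)) @^-1` D) = (m1 \x m2) D.
Proof.
move=> mX mY mXY D mD.
have mZ : measurable_fun [set: T] (fun w => (X w, Y w)) by exact: measurable_fun_pair.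
pose Z : {mfun T >-> (T1 * T2)%type} := mfun_Sub (mem_set mZ).
by rewrite (@product_measure_unique _ _ _ _ _ m1 m2 (pushforward m Z)).
Qed.

End joint_law.

Section independence.
Local Open Scope ereal_scope.
Context {d} {T : measurableType d} {R : realType} (P : probability T R).

Lemma independent3_pair (g h q : {RV P >-> R}) : independent3 g h q ->
  forall (A : set R) (C : set (R * R)), measurable A -> measurable C ->
  P (g @^-1` A `&` (fun w => (h w, q w)) @^-1` C) =
  P (g @^-1` A) * P ((fun w => (h w, q w)) @^-1` C).
Proof.
move=> ind A C mA mC.
have mgA : measurable (g @^-1` A) by exact: measurable_funPTI.
have law (B : set R) : measurable B ->
    P (g @^-1` B `&` (fun w => (h w, q w)) @^-1` C) =
    P (g @^-1` B) * (distribution P h \x distribution P q) C.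
  move=> mB; have mgB : measurable (g @^-1` B) by exact: measurable_funPTI.
  pose r : {nonneg R} := NngNum (fine_ge0 (measure_ge0 P (g @^-1` B))).
  rewrite setIC -/(mrestr P mgB _).
  rewrite (pair_law (mrestr P mgB) (mscale r (distribution P h))
    (distribution P q))//.
    rewrite /product_measure1 ge0_integral_mscale//=.
      by rewrite fineK// fin_num_measure.
    exact: measurable_fun_xsection.
  move=> E F mE mF; rewrite /mrestr/= [X in P X = _]setIC setIA ind//.
  by rewrite /mscale/= fineK// fin_num_measure.
rewrite law//; congr (_ * _).
by have := law setT measurableT; rewrite preimage_setT setTI probability_setT mul1e.
Qed.

(** Fubini's theorem for the product law: conditioning on [X]. *)
Lemma independent_section_prob (X Y : {RV P >-> R}) :
  (forall A B : set R, measurable A -> measurable B ->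
    P (X @^-1` A `&` Y @^-1` B) = P (X @^-1` A) * P (Y @^-1` B)) ->
  forall D : set (R * R), measurable D ->
  P ((fun w => (X w, Y w)) @^-1` D) =
  \int[P]_w distribution P Y (xsection D (X w)).
Proof.
move=> ind D mD.
rewrite (pair_law P (distribution P X) (distribution P Y))//.
rewrite /product_measure1 ge0_integral_distribution//.
exact: measurable_fun_xsection.
Qed.

End independence.

(** * Distribution function of the exponential law *)

Section exponential.
Context {R : realType}.

Lemma exponential_prob_le (r y : R) : 0 < r -> 0 <= y ->
  exponential_prob r `]-oo, y] = (1 - expR (- (r * y)))%:E.
Proof.
move=> r0 y0.
have -> : exponential_prob r `]-oo, y] = exponential_prob r `[0, y].
  rewrite /exponential_prob [LHS]integral_mkcond [RHS]integral_mkcond.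
  apply: eq_integral => x _; rewrite !patchE; case: ifPn; case: ifPn => //.
    rewrite notin_setE/= in_itv/= inE/= in_itv/= => nx xy.
    rewrite lt0_exponential_pdf// ltNge; apply/negP => x0; apply: nx.
    by rewrite x0.
  by rewrite inE/= in_itv/= => /andP[_ xy]; rewrite notin_setE/= in_itv/= xy.
have [->|yn] := eqVneq y 0.
  by rewrite mulr0 oppr0 expR0 subrr set_itv1 /exponential_prob integral_set1.
by rewrite exponential_prob_itv0c ?lt_neqAle 1?eq_sym ?yn// mulNr.
Qed.

End exponential.

(** * Existence and uniqueness of quantiles *)

Section hazard_quantile.
Context {R : realType}.
Variables (L : R -> R) (beta : R).
Hypothesis beta_gt0 : 0 < beta.
Hypothesis L0 : L 0 = 0.
Hypothesis L_ge : forall x y : R, 0 <= x -> x <= y -> beta * (y - x) <= L y - L x.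
Hypothesis L_le : forall x y : R, 0 < x -> x <= y -> L y - L x <= (y - x) * (L x / x).

Lemma hazard_inj (x y : R) : 0 <= x -> 0 <= y -> L x = L y -> x = y.
Proof.
move=> x0 y0 Lxy; wlog xy : x y x0 y0 Lxy / x <= y.
  by move=> h; have [/h|/ltW/h] := leP x y; [exact|move=> ->].
have := L_ge _ _ x0 xy; rewrite Lxy subrr pmulr_rle0// subr_le0 => yx.
by apply/eqP; rewrite eq_le xy.
Qed.

(** By [L_le] at [x / 2], the ratio [L u / u] is at most its value [k] at [x / 2] for all
    [u >= x / 2]; a second use of [L_le] makes [L] Lipschitz with constant [k] there. *)
Lemma hazard_continuous (x : R) : 0 < x -> {for x, continuous L}.
Proof.
move=> x0; have x20 : 0 < x / 2 by rewrite divr_gt0.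
have L_ge0 u : 0 <= u -> 0 <= L u.
  move=> u0; have := L_ge _ _ (lexx _) u0; rewrite L0 !subr0; apply: le_trans.
  by rewrite mulr_ge0// ltW.
set k := L (x / 2) / (x / 2).
have k0 : 0 <= k by rewrite divr_ge0 ?L_ge0// ltW.
have ratio u : x / 2 <= u -> L u / u <= k.
  move=> xu; have u0 : 0 < u by exact: lt_le_trans xu.
  have := L_le _ _ x20 xu; rewrite -/k => h.
  have kE : L (x / 2) = k * (x / 2) by rewrite divfK ?gt_eqF.
  by rewrite ler_pdivrMr//; move: h; rewrite kE; lra.
have lip u v : x / 2 <= u -> u <= v -> `|L v - L u| <= k * (v - u).
  move=> xu uv; have u0 : 0 < u by exact: lt_le_trans xu.
  rewrite ger0_norm.
    apply: le_trans (L_le _ _ u0 uv) _.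
    by rewrite mulrC ler_wpM2r ?subr_ge0// ratio.
  by apply: le_trans (L_ge _ _ (ltW u0) uv); rewrite mulr_ge0 ?subr_ge0 ?(ltW beta_gt0).
apply/cvgrPdist_le => e e0; near=> y.
have y2 : x / 2 <= y.
  by near: y; apply: (cvgr_ge x); [exact: cvg_id|lra].
have xy : `|x - y| <= e / (k + 1).
  by near: y; apply: (@cvgr_dist_le _ R^o _ _ _ id x); [exact: cvg_id|rewrite divr_gt0//; lra].
apply: (@le_trans _ _ (k * `|x - y|)).
  have [h|/ltW h] := leP x y.
    rewrite distrC [`|x - y|]distrC [`|y - x|]ger0_norm ?subr_ge0// lip//; lra.
  by rewrite [`|x - y|]ger0_norm ?subr_ge0// lip.
apply: (@le_trans _ _ (k * (e / (k + 1)))); first by rewrite ler_wpM2l.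
rewrite mulrCA ger_pMr// ler_pdivrMr; lra.
Unshelve. all: by end_near. Qed.

(** Intermediate value theorem on [[1, M]], away from [0] because continuity is known on the open
    half-line. [M = 1 + t / beta] works since [L M >= beta * M >= t]. *)
Lemma hazard_quantile (t : R) : L 1 <= t -> exists2 x, 0 <= x & L x = t.
Proof.
move=> L1t.
have t0 : 0 <= t.
  apply: le_trans L1t; have := L_ge _ _ (lexx _) ler01; rewrite L0 !subr0 mulr1.
  exact: le_trans (ltW _).
pose M := 1 + t / beta.
have M1 : 1 <= M by rewrite lerDl divr_ge0// ltW.
have M0 : 0 <= M by exact: le_trans M1.
have tM : t <= L M.
  have := L_ge _ _ (lexx _) M0; rewrite L0 !subr0 /M mulrDr mulr1 mulrCA mulfV ?gt_eqF// mulr1.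
  by apply: le_trans; rewrite lerDr ltW.
have [||c] := @IVT _ L 1 M t M1.
- apply: continuous_in_subspaceT => x; rewrite inE/= in_itv/= => /andP[x1 _].
  by apply: hazard_continuous; exact: lt_le_trans x1.
- by rewrite ge_min L1t/= le_max tM orbT.
- by rewrite in_itv/= => /andP[c1 _] Lc; exists c => //; exact: le_trans c1.
Qed.

Variable F : R -> R.
Hypothesis FE : forall x, 0 <= x -> F x = 1 - expR (- L x).

(** [F] is injective on [[0, +oo[] because [L] is, so the partial inverse returns the quantile of
    [L]. It is used at [t = ln N] and [t = ln N + 1]. *)
Lemma cdf_inv_quantile (t : R) : L 1 <= t ->
  0 <= cdf_inv F (1 - expR (- t)) /\ L (cdf_inv F (1 - expR (- t))) = t.
Proof.
move=> /hazard_quantile[x x0 Lx].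
have xD : x \in (`[0, +oo[%classic : set R) by rewrite inE/= in_itv/= x0.
have -> : 1 - expR (- t) = F x by rewrite FE// Lx.
rewrite /cdf_inv pinvKV// => u v; rewrite !inE/= !in_itv/= !andbT => u0 v0.
by rewrite !FE// => /addrI/oppr_inj/expR_inj/oppr_inj/hazard_inj; exact.
Qed.

End hazard_quantile.

(** * Law of the SINR of one antenna *)

Section sinr_law.
Context {R : realType}.
Variables (Q Pmax Pp sigma2 gbar hbar qbar : R).
Hypotheses (Q_gt0 : 0 < Q) (Pmax_gt0 : 0 < Pmax) (Pp_gt0 : 0 < Pp)
  (sigma2_gt0 : 0 < sigma2)
  (gbar_gt0 : 0 < gbar) (hbar_gt0 : 0 < hbar) (qbar_gt0 : 0 < qbar).
Context {d : measure_display} {T : measurableType d} (P : probability T R).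
Variables (g h q : {RV P >-> R}).
Hypotheses (g_exp : exponential_with_mean g gbar)
  (h_exp : exponential_with_mean h hbar) (q_exp : exponential_with_mean q qbar)
  (ghq_indep : independent3 g h q).

(* Off a null set the SINR is g divided by this function of (h, q), so that
   given (h, q) its tail is exponential. *)
Definition interference (hq : R * R) : R :=
  (Pp * Num.max hq.2 0 + sigma2) * Num.max (hq.1 / Q) Pmax^-1.

(** The variable [W] of the Laplace transform: as [g] has rate [gbar^-1], the SINR exceeds [x >= 0]
    with probability [expR (- (x * attenuation w))] given [(h, q)]. *)
Definition attenuation (w : T) : R := gbar^-1 * interference (h w, q w).

(** The value of [attenuation] when [q = 0] and [h <= Q / Pmax]. *)
Definition attenuation_inf : R := sigma2 / (Pmax * gbar).

Lemma measurable_interference : measurable_fun [set: R * R] interference.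
Proof.
apply: measurable_funM.
  apply: measurable_funD => //; apply: measurable_funM => //.
  exact: measurable_maxr.
by apply: measurable_maxr => //; exact: measurable_funM.
Qed.

Let mhq : measurable_fun [set: T] (fun w => (h w, q w)).
Proof. exact: measurable_fun_pair. Qed.

Let mV : measurable_fun [set: T] (fun w => interference (h w, q w)).
Proof. exact: (measurableT_comp measurable_interference mhq). Qed.

Lemma measurable_attenuation : measurable_fun [set: T] attenuation.
Proof. exact: measurable_funM. Qed.

Lemma attenuation_inf_gt0 : 0 < attenuation_inf.
Proof. by rewrite divr_gt0// mulr_gt0. Qed.

(** The maximum with [0] in [interference] makes this hold at every point, not only almost
    surely. *)
Let interference_ge hq : sigma2 / Pmax <= interference hq.
Proof.
rewrite ler_pM// ?invr_ge0 ?(ltW Pmax_gt0) ?(ltW sigma2_gt0)//.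
  by rewrite lerDr mulr_ge0 ?(ltW Pp_gt0)// le_max lexx orbT.
by rewrite le_max lexx orbT.
Qed.

Lemma attenuation_ge w : attenuation_inf <= attenuation w.
Proof.
rewrite /attenuation_inf /attenuation invfM mulrA mulrC ler_pM2l ?invr_gt0//.
Qed.

Lemma exponential_le (X : {RV P >-> R}) (m y : R) : 0 < m ->
  exponential_with_mean X m -> 0 <= y ->
  P (X @^-1` `]-oo, y]) = (1 - expR (- (m^-1 * y)))%:E.
Proof.
move=> m0 X_exp y0; rewrite -exponential_prob_le ?invr_gt0//.
by rewrite -X_exp.
Qed.

(** The event contains [h <= Q / Pmax] together with [q <= dl], which has positive probability by
    independence. *)
Lemma attenuation_essinf (e : R) : 0 < e ->
  (0 < P [set w | (attenuation w <= attenuation_inf + e)%R])%E.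
Proof.
(* Chosen so that [Pp * dl / (Pmax * gbar) = e]. *)
move=> e0; pose dl := e * Pmax * gbar / Pp.
have dl0 : 0 < dl by rewrite divr_gt0// !mulr_gt0.
have mA : measurable [set w | attenuation w <= attenuation_inf + e].
  by rewrite -[X in measurable X]setTI; apply: measurable_fun_le => //;
    exact: measurable_attenuation.
have mI (X : {RV P >-> R}) y : measurable (X @^-1` `]-oo, y]).
  exact: measurable_funPTI.
apply: (@lt_le_trans _ _ (P (h @^-1` `]-oo, Q / Pmax] `&` q @^-1` `]-oo, dl]))).
  have := ghq_indep setT `]-oo, Q / Pmax]%classic `]-oo, dl]%classic
    measurableT (measurable_itv _) (measurable_itv _).
  rewrite preimage_setT setTI probability_setT mul1e => ->.
  rewrite (exponential_le _ _ _ hbar_gt0)// ?(exponential_le _ _ _ qbar_gt0)//.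
  - by rewrite -EFinM lte_fin mulr_gt0// subr_gt0 expR_lt1 oppr_lt0 mulr_gt0// ?invr_gt0// divr_gt0.
  - exact: ltW.
  - by rewrite divr_ge0// ltW.
apply: le_measure; rewrite ?inE//; first exact: measurableI.
move=> w [/=]; rewrite !in_itv/= => hw qw.
rewrite /attenuation /interference/=.
have h1 : Num.max (h w / Q) Pmax^-1 <= Pmax^-1.
  by rewrite ge_max lexx andbT ler_pdivrMr// mulrC.
have q1 : Num.max (q w) 0 <= dl by rewrite ge_max qw ltW.
have -> : attenuation_inf + e = gbar^-1 * ((Pp * dl + sigma2) * Pmax^-1).
  rewrite /attenuation_inf /dl; field.
  by rewrite !gt_eqF.
rewrite ler_pM2l ?invr_gt0// ler_pM//.
- by rewrite addr_ge0 ?mulr_ge0 ?(ltW Pp_gt0) ?(ltW sigma2_gt0)// le_max lexx orbT.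
- by rewrite le_max invr_ge0 (ltW Pmax_gt0) orbT.
- by rewrite lerD2r ler_pM2l.
Qed.

(** Where [h] and [q] are positive so are the denominators, and a minimum of two quotients is at
    most [x] exactly when one of them is; this produces the maximum in [interference]. *)
Lemma cdf_sinr_preimage (x : R) : 0 <= x ->
  cdf (sinr Q Pmax Pp sigma2 g h q : {RV P >-> R}) x =
  P [set w | (g w <= x * interference (h w, q w))%R].
Proof.
move=> x0.
pose A := (sinr Q Pmax Pp sigma2 g h q : T -> R) @^-1` `]-oo, x]%classic.
pose B := [set w | (g w <= x * interference (h w, q w))%R].
pose N := h @^-1` `]-oo, 0] `|` q @^-1` `]-oo, 0].
have mI (X : {RV P >-> R}) y : measurable (X @^-1` `]-oo, y]).
  exact: measurable_funPTI.
have mA : measurable A by exact: (mI (sinr Q Pmax Pp sigma2 g h q)).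
have mB : measurable B.
  by rewrite -[X in measurable X]setTI; apply: measurable_fun_le => //;
    exact: measurable_funM.
have P0 (X : {RV P >-> R}) m : 0 < m -> exponential_with_mean X m ->
    P (X @^-1` `]-oo, 0]) = 0%E.
  by move=> m0 /(exponential_le _ _ _ m0) ->//; rewrite mulr0 oppr0 expR0 subrr.
have N0 : P N = 0%E.
  apply: null_set_setU => //.
    exact: (P0 _ _ hbar_gt0).
  exact: (P0 _ _ qbar_gt0).
have mN : measurable N by exact: measurableU.
(* Adjoining the null set [N] to both events leaves an equivalence to check only where [h] and [q]
   are positive. *)
rewrite [LHS](_ : _ = P A)// -(measureU0 mA mN N0) -[RHS](measureU0 mB mN N0).
congr (P _).
have AB w : ~ N w -> A w <-> B w.
  move=> /not_orP[/=]; rewrite !in_itv/= => /negP; rewrite -ltNge => hw.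
  move=> /negP; rewrite -ltNge => qw.
  have Y0 : 0 < Pp * q w + sigma2 by rewrite addr_gt0// mulr_gt0.
  rewrite /A /B /interference /sinr/= in_itv/= (max_l (ltW qw)).
  rewrite ge_min !ler_pdivrMr ?mulr_gt0//.
  have -> : (Q * g w <= x * (h w * (Pp * q w + sigma2))) =
      (g w <= x * ((Pp * q w + sigma2) * (h w / Q))).
    rewrite -(ler_pM2l Q_gt0 (g w)); congr (_ <= _); field; rewrite gt_eqF//.
  have -> : (Pmax * g w <= x * (Pp * q w + sigma2)) =
      (g w <= x * ((Pp * q w + sigma2) * Pmax^-1)).
    rewrite -(ler_pM2l Pmax_gt0 (g w)); congr (_ <= _); field; rewrite gt_eqF//.
  by rewrite !maxr_pMr ?(ltW Y0)// le_max.
apply/seteqP; split => w [H|Nw]; try (by right).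
- by have [Nw|Nw] := pselect (N w); [right|left; apply/AB].
- by have [Nw|Nw] := pselect (N w); [right|left; apply/AB].
Qed.

(** The interference is a function of [(h, q)], hence independent of [g]. Conditioning on it and
    integrating the exponential distribution function of [g] gives one minus the Laplace transform
    of [attenuation]. *)
Lemma sinr_cdfE (x : R) : 0 <= x ->
  sinr_cdf Q Pmax Pp sigma2 g h q x = 1 - expR (- hazard P attenuation x).
Proof.
move=> x0.
have m1 := measurable_attenuation.
rewrite (expR_hazard P _ _ m1 attenuation_inf_gt0 attenuation_ge attenuation_essinf)//.
rewrite /sinr_cdf cdf_sinr_preimage//.
pose V : {RV P >-> R} := mfun_Sub (mem_set mV).
pose D : set (R * R) := [set p | p.2 <= x * p.1].
have mD : measurable D.
  by rewrite -[X in measurable X]setTI; apply: measurable_fun_le => //;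
    exact: measurable_funM.
have VgI (A B : set R) : measurable A -> measurable B ->
    (P (V @^-1` A `&` g @^-1` B) = P (V @^-1` A) * P (g @^-1` B))%E.
  move=> mA mB; rewrite setIC muleC.
  have -> : V @^-1` A = (fun w => (h w, q w)) @^-1` (interference @^-1` A) by [].
  apply: independent3_pair => //.
  by rewrite -[X in measurable X]setTI; exact: measurable_interference.
rewrite -[X in P X]/((fun w => (V w, g w)) @^-1` D) (independent_section_prob P _ _ VgI)//.
rewrite (eq_integral (fun w => (1 - expR (- (x * attenuation w)))%:E)); last first.
  move=> w _.
  have xV : 0 <= x * interference (h w, q w).
    by rewrite mulr_ge0// (le_trans _ (interference_ge _))// divr_ge0// ltW.
  have -> : xsection D (V w) = `]-oo, x * interference (h w, q w)]%classic.
    by apply/seteqP; split => u; rewrite /xsection/= in_itv/= inE.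
  rewrite [LHS](exponential_le _ _ _ gbar_gt0 g_exp xV) /attenuation.
  by rewrite mulrCA.
rewrite -[fine _]/(\int[P]_w (1 - expR (- (x * attenuation w))))%R.
rewrite RintegralB//.
- rewrite Rintegral_cst//=; congr (_ - _).
  by rewrite (_ : _ setT = 1%E) ?mul1r//; exact: probability_setT.
- exact: finite_measure_integrable_cst.
- exact: (laplace_integrable P _ _ m1 attenuation_inf_gt0 attenuation_ge).
Qed.

End sinr_law.

Theorem mainTheorem2 (R : realType)
  (Q Pmax Pp sigma2 gbar hbar qbar : R)
  (Q_gt0 : 0 < Q) (Pmax_gt0 : 0 < Pmax) (Pp_gt0 : 0 < Pp)
  (sigma2_gt0 : 0 < sigma2)
  (gbar_gt0 : 0 < gbar) (hbar_gt0 : 0 < hbar) (qbar_gt0 : 0 < qbar)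
  (d : measure_display) (T : measurableType d) (P : probability T R)
  (g h q : {RV P >-> R})
  (g_exp : exponential_with_mean g gbar)
  (h_exp : exponential_with_mean h hbar)
  (q_exp : exponential_with_mean q qbar)
  (ghq_indep : independent3 g h q)
  (dS : nat -> measure_display) (S : forall N : nat, measurableType (dS N))
  (PS : forall N : nat, probability (S N) R)
  (Rmax : forall N : nat, {RV (PS N) >-> R})
  (Rmax_ge0 : forall N : nat, (0 < N)%N -> forall w : S N, 0 <= Rmax N w)
  (Rmax_cdf : forall N : nat, (0 < N)%N -> forall r : R, 0 <= r ->
     cdf (Rmax N) r
     = ((sinr_cdf Q Pmax Pp sigma2 g h q (expR r - 1)) ^+ N)%:E) :
  let F := sinr_cdf Q Pmax Pp sigma2 g h q in
  (('E_(PS N)[Rmax N] - (capacity_a F N)%:E) / (capacity_b F N)%:E)%E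
    @[N --> \oo] --> (euler_constant R)%:E.
Proof.
move=> F.
pose W := attenuation Q Pmax Pp sigma2 gbar P h q.
pose beta := attenuation_inf Pmax sigma2 gbar.
pose L := hazard P W.
have mW : measurable_fun [set: T] W by exact: measurable_attenuation.
have beta_gt0 : 0 < beta by exact: attenuation_inf_gt0.
have W_ge w : beta <= W w by exact: attenuation_ge.
have W_essinf (e : R) : 0 < e -> (0 < P [set w | (W w <= beta + e)%R])%E.
  exact: (attenuation_essinf Q Pmax Pp sigma2 gbar hbar qbar _ _ _ _ _ _ _ P g).
have L0 : L 0 = 0 by exact: hazard0.
have L_ge (x y : R) : 0 <= x -> x <= y -> beta * (y - x) <= L y - L x.
  exact: (hazard_increment_lower P W beta).
have L_le (x y : R) : 0 < x -> x <= y -> L y - L x <= (y - x) * (L x / x).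
  exact: (hazard_increment_upper P W beta).
have L_ratio : L x / x @[x --> +oo] --> beta by exact: cvg_hazard_ratio.
have FE x : 0 <= x -> F x = 1 - expR (- L x) by exact: (sinr_cdfE Q Pmax Pp sigma2 gbar hbar qbar).
have inv_quantile t := cdf_inv_quantile L beta beta_gt0 L0 L_ge L_le F FE t.
pose x (N : nat) := cdf_inv F (1 - N%:R^-1).
pose z (N : nat) := cdf_inv F (1 - (N%:R * expR 1)^-1).
(* [cdf_inv_quantile] applies only from the level [L 1] on. *)
have lnoo : \forall N \near \oo, L 1 <= ln (N%:R : R).
  near=> N.
  have : expR (L 1) <= N%:R.
    by near: N; have /cvgryPge := @cvgr_idn R; exact.
  by move=> e; rewrite -[leLHS]expRK ler_ln ?posrE ?expR_gt0// (lt_le_trans (expR_gt0 _) e).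
have xP : \forall N \near \oo, 0 <= x N /\ L (x N) = ln N%:R.
  near=> N.
  have N0 : (0 < N)%N by near: N; exact: nbhs_infty_gt.
  have -> : x N = cdf_inv F (1 - expR (- ln N%:R)).
    by rewrite /x expRN lnK// posrE ltr0n.
  by apply: inv_quantile; near: N.
have zP : \forall N \near \oo, 0 <= z N /\ L (z N) = ln N%:R + 1.
  near=> N.
  have N0 : (0 < N)%N by near: N; exact: nbhs_infty_gt.
  (* [N * e = expR (ln N + 1)]: this is the quantile one unit of hazard further. *)
  have -> : z N = cdf_inv F (1 - expR (- (ln N%:R + 1))).
    by rewrite /z expRN expRD lnK// posrE ltr0n.
  apply: inv_quantile.
  have : L 1 <= ln (N%:R : R) by near: N.
  lra.
have x_ge0 : \forall N \near \oo, 0 <= x N by apply: filterS xP => N [].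
have Lx : \forall N \near \oo, L (x N) = ln N%:R by apply: filterS xP => N [].
have z_ge0 : \forall N \near \oo, 0 <= z N by apply: filterS zP => N [].
have Lz : \forall N \near \oo, L (z N) = ln N%:R + 1 by apply: filterS zP => N [].
pose a N := capacity_a F N; pose b N := capacity_b F N.
(* Distribution function of [(Rmax N - a N) / b N] when [b N > 0]. *)
pose K N s := fine (cdf (Rmax N) (a N + b N * s)).
have mK N : measurable_fun [set: R] (K N).
  have mc : measurable_fun [set: R] (fun r => fine (cdf (Rmax N) r)).
    apply: measurableT_comp; first exact: fine_measurable.
    exact: cdf_measurable.
  by apply: (measurableT_comp mc); apply: measurable_funD => //; exact: measurable_funM.
(* Negative rates correspond to levels [y < 0], where the individual tail is set to [1]. *)
have cdf_lt0 N r : (0 < N)%N -> r < 0 -> cdf (Rmax N) r = 0%E.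
  move=> N0 r0; rewrite -[LHS]/(PS N (Rmax N @^-1` `]-oo, r])).
  rewrite (_ : _ @^-1` _ = set0) ?measure0//.
  rewrite -subset0 => w /=; rewrite in_itv/= => h0.
  by have := Rmax_ge0 N N0 w; rewrite leNgt (le_lt_trans h0 r0).
have := cvg_tail_gap_max L beta beta_gt0 L0 L_ge L_le L_ratio x z x_ge0 z_ge0 Lx Lz K mK.
set c := euler_constant R.
have KE : \forall N \near \oo, forall s, K N s =
    (1 - (if 0 <= (1 + x N) * expR (ln ((1 + z N) / (1 + x N)) * s) - 1 then
      expR (- L ((1 + x N) * expR (ln ((1 + z N) / (1 + x N)) * s) - 1)) else 1)) ^+ N.
  near=> N => s.
  have N0 : (0 < N)%N by near: N; exact: nbhs_infty_gt.
  have x0 : 0 <= x N by near: N.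
  have x1 : 0 < 1 + x N by lra.
  have yE : (1 + x N) * expR (ln ((1 + z N) / (1 + x N)) * s) = expR (a N + b N * s).
    by rewrite expRD /a /capacity_a lnK// posrE.
  rewrite yE subr_ge0 -expR0 ler_expR /K.
  case: ifPn => [r0|]; last first.
    by rewrite -ltNge => r0; rewrite cdf_lt0// expR0 subrr expr0n gtn_eqF.
  rewrite Rmax_cdf//= expR0 -/F FE// subr_ge0 -expR0 ler_expR//.
move=> /(_ KE); apply: cvg_trans; apply: near_eq_cvg; near=> N.
have N0 : (0 < N)%N by near: N; exact: nbhs_infty_gt.
have b0 : 0 < b N.
  near: N; exact: (quantile_gap_gt0 L beta beta_gt0 L0 L_ge L_le L_ratio x z).
apply/esym/expectation_standardise => //.
(* By Bernoulli the tail of [Rmax N] at [r] is at most [N * expR (- L (expR r - 1))], and [L (expR r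
   - 1) >= beta * (expR r - 1) >= beta * r]. *)
apply: (Lfun1_exponential_tail (PS N) (Rmax N) N%:R beta beta_gt0); first exact: Rmax_ge0.
move=> r r0.
have y0 : 0 <= expR r - 1 by rewrite subr_ge0 -expR0 ler_expR.
rewrite ccdf_1_cdf Rmax_cdf// -/F FE// -EFinB lee_fin.
have LB : beta * r <= L (expR r - 1).
  have := L_ge 0 _ (lexx _) y0; rewrite L0 !subr0; apply: le_trans.
  by rewrite ler_pM2l//; have := expR_ge1Dx r; lra.
have r1 : 0 <= beta * r by rewrite mulr_ge0// ltW.
apply: le_trans (one_minus_exprn_le _ N _) _.
  by rewrite expR_ge0 expR_le1 oppr_le0 (le_trans r1).
by rewrite ler_wpM2l// ler_expR lerN2.
Unshelve. all: by end_near. Qed.
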